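(* Let $H_2=\mathrm{FSym}(\mathbb{Z})\rtimes\langle t\rangle$ be the second Houghton group, where $\mathrm{FSym}(\mathbb{Z})$ is the group of permutations of $\mathbb{Z}$ with finite support and $t$ is the shift $t(k)=k-1$. Then $H_2$ is finitely generated and acts properly, preserving factors, on a product of two trees, but $H_2$ does not act properly (whether preserving factors or not) on the product of any finite number of locally finite trees.
   Context: All trees are simplicial trees, regarded as metric spaces with each edge of length 1. A tree is locally finite if every vertex has finite valence. A finite product $P=T_1\times\dots\times T_n$ of trees carries its natural cube complex structure (and the $\ell_2$ product metric). An action of a group $G$ on $P$ is a homomorphism from $G$ to the group $\mathrm{Aut}(P)$ of automorphisms of the cube complex $P$; it may permute factors, may invert edges, and need not be faithful. The action preserves factors if its image lies in $\mathrm{Aut}(T_1)\times\dots\times \mathrm{Aut}(T_n)$, where $\mathrm{Aut}(T_i)$ is the group of simplicial automorphisms of $T_i$. The action is proper if the stabiliser in $G$ of every vertex of $P$ is a finite group. *)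

(* Defs.v *)
From HB Require Import structures.
From mathcomp Require Import all_boot all_order all_algebra.
From mathcomp Require Import boolp classical_sets cardinality.

Set Implicit Arguments.
Unset Strict Implicit.
Unset Printing Implicit Defensive.

Import GRing.Theory.

Local Open Scope classical_set_scope.
Local Open Scope group_scope.

(* The symmetric group of an arbitrary type; the product is composition,
   (f * g) x = f (g x), so that homomorphisms into it are left actions. *)
Record sym (X : Type) := Sym {
  sym_fun :> X -> X;
  sym_inv : X -> X;
  symK : cancel sym_fun sym_inv;
  symVK : cancel sym_inv sym_fun }.

Section SymGroup.
Variable X : Type.
Implicit Types f g h : sym X.

Lemma sym_eqP f g : f =1 g -> f = g.
Proof.
case: f g => [f f' fK f'K] [g g' gK g'K] /= /funext fg.
move: gK g'K; rewrite -fg => gK g'K.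
have e : f' = g' by apply/funext => x; rewrite -{1}(g'K x) fK.
by rewrite -e in gK g'K *; congr Sym; apply: Prop_irrelevance.
Qed.

HB.instance Definition _ := gen_eqMixin (sym X).
HB.instance Definition _ := gen_choiceMixin (sym X).

Definition sym1 : sym X := @Sym X id id (fun=> erefl) (fun=> erefl).
Definition symV f : sym X := Sym (@symVK X f) (@symK X f).
Definition symM f g : sym X :=
  Sym (can_comp (@symK X f) (@symK X g)) (can_comp (@symVK X g) (@symVK X f)).

Lemma symMA : associative symM. Proof. by move=> f g h; apply: sym_eqP. Qed.
Lemma sym1M : left_id sym1 symM. Proof. by move=> f; apply: sym_eqP. Qed.
Lemma symM1 : right_id sym1 symM. Proof. by move=> f; apply: sym_eqP. Qed.
Lemma symVM : left_inverse sym1 symV symM.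
Proof. by move=> f; apply: sym_eqP => x; apply: symK. Qed.
Lemma symMV : right_inverse sym1 symV symM.
Proof. by move=> f; apply: sym_eqP => x; apply: symVK. Qed.

HB.instance Definition _ :=
  isGroup.Build (sym X) symMA sym1M symM1 symVM symMV.

Lemma symME f g x : (f * g) x = f (g x). Proof. by []. Qed.
Lemma symVE f x : f^-1 x = sym_inv f x. Proof. by []. Qed.
Lemma sym1E x : (1 : sym X) x = x. Proof. by []. Qed.

End SymGroup.

Definition generated (G : groupType) (S : set G) : set G :=
  smallest (fun A : set G => group_closed (mem A)) S.

Definition finitely_generated (G : groupType) : Prop :=
  exists2 S : set G, finite_set S & generated S = [set: G].

Section Houghton.

Lemma shiftK : cancel (fun k : int => k - 1)%R (fun k : int => k + 1)%R.
Proof. by move=> k; rewrite subrK. Qed.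

Lemma shiftVK : cancel (fun k : int => k + 1)%R (fun k : int => k - 1)%R.
Proof. by move=> k; rewrite addrK. Qed.

Definition shift : sym int := Sym shiftK shiftVK.

Definition FSym (X : Type) : set (sym X) :=
  [set s | finite_set [set x | s x <> x]].

Lemma FSym_group X : group_closed (mem (@FSym X)).
Proof.
split=> [|f g]; rewrite !in_setE /FSym /=.
  by apply: (sub_finite_set _ (finite_set0 X)) => x /=; apply.
move=> ff fg.
have: finite_set ([set x | f x <> x] `|` [set x | g x <> x]).
  by rewrite finite_setU.
apply: sub_finite_set => x /=.
apply: contra_notP => /not_orP[/contrapT fx /contrapT gx].
have gVx : g^-1 x = x by rewrite -{1}gx symVE symK.
by rewrite -symVE gVx.
Qed.

Lemma FSym_normal X (s c : sym X) : FSym s -> FSym (s ^ c).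
Proof.
move=> fs; have := finite_image (c^-1) fs; apply: sub_finite_set => x scx.
exists (c x); last exact: symK.
apply: contra_not scx => scx.
exact: etrans (congr1 (sym_inv c) scx) (symK c x).
Qed.

Lemma generated_group (G : groupType) (S : set G) :
  group_closed (mem (generated S)).
Proof.
split=> [|f g]; rewrite !in_setE; first by move=> A [[A1 _] _]; apply/set_mem.
move=> gf gg A AS; case: (AS) => -[_ AV] _.
by apply/set_mem/AV; apply/mem_set; [apply: gf | apply: gg].
Qed.

Lemma generated_shift (c : sym int) :
  generated [set shift] c -> exists n : int, forall k, c k = (k + n)%R.
Proof.
suff: generated [set shift] `<=`
    [set c : sym int | exists n : int, forall k, c k = (k + n)%R] by apply.
apply: smallest_sub; last by move=> _ ->; exists (-1)%R.
split=> [|f g]; rewrite !in_setE; first by exists 0%R => k; rewrite addr0.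
move=> [n fn] [m gm]; exists (n - m)%R => k; rewrite symME fn.
suff -> : g^-1 k = (k - m)%R by rewrite addrAC addrA.
by rewrite -[in LHS](subrK m k) -gm; apply: symK.
Qed.

Lemma FSym_shift_trivial (c : sym int) :
  FSym c -> generated [set shift] c -> c = 1.
Proof.
move=> fc /generated_shift[n cn]; apply: sym_eqP => k; rewrite sym1E cn.
have [->|n0] := eqVneq n 0%R; first by rewrite addr0.
suff ft : finite_set [set: int].
  have: infinite_set [set: nat] by apply/infiniteP/card_lexx.
  case; apply: sub_finite_set (finite_image absz ft) => m _.
  by exists (Posz m).
apply: sub_finite_set (fc : finite_set [set j | c j <> j]) => j _.
rewrite /= cn => /eqP.
by rewrite -subr_eq0 addrAC subrr add0r (negPf n0).
Qed.

(* The internal semidirect product FSym(Z) ><| <t> inside Sym(Z); see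
   FSym_group, generated_group, FSym_normal and FSym_shift_trivial. *)
Definition houghton2_set : set (sym int) :=
  [set s * c | s in @FSym int & c in generated [set shift]].

Lemma houghton2_group : group_closed (mem houghton2_set).
Proof.
have [F1 FV] := FSym_group int; have [T1 TV] := generated_group [set shift].
split=> [|_ _ /set_mem[s fs [c gc <-]] /set_mem[s' fs' [c' gc' <-]]].
  apply/mem_set; exists 1; first exact/set_mem.
  by exists 1; [exact/set_mem | rewrite mulg1].
have gd : generated [set shift] (c / c') by apply/set_mem/TV; apply/mem_set.
have fs'' : FSym (s' ^ (c / c')^-1) by exact: FSym_normal.
apply/mem_set; exists (s / s' ^ (c / c')^-1).
  by apply/set_mem/FV; apply/mem_set.
exists (c / c') => //; rewrite conjgE invgK !invgM invgK.
by rewrite !invgK !mulgA mulgVK mulgK.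
Qed.

Record houghton2 := Houghton2 {
  houghton2_val :> sym int;
  houghton2_valP : houghton2_val \in houghton2_set }.

HB.instance Definition _ := [isSub for houghton2_val].
HB.instance Definition _ := [Choice of houghton2 by <:].
HB.instance Definition _ :=
  SubChoice_isSubGroup.Build (sym int) (mem houghton2_set) houghton2
    houghton2_group.

End Houghton.

(* The vertex set being an eqType is no restriction classically. The one-vertex
   tree is allowed, the empty graph is not. *)
Record tree := Tree {
  vertex :> eqType;
  adj : rel vertex;
  adj_sym : symmetric adj;
  adj_irr : irreflexive adj;
  tree_nonempty : inhabited vertex;
  tree_connected : forall x y : vertex,
    exists2 p : seq vertex, path adj x p & last x p = y;
  tree_acyclic : forall p : seq vertex, ucycle adj p -> (size p <= 2)%N }.

Definition locally_finite (T : tree) : Prop :=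
  forall x : T, finite_set [set y : T | adj x y].

(* Cells of a tree and of a product of trees are represented by their vertex
   sets, which determine them. *)
Definition simplex (T : tree) (A : set T) : Prop :=
  (exists x : T, A = [set x]) \/
  (exists x y : T, adj x y /\ A = [set x; y]).

Section Product.
Variables (n : nat) (T : 'I_n -> tree).

Definition prod_vertex : Type := forall i, T i.

Definition cube (C : set prod_vertex) : Prop :=
  exists2 F : forall i, set (T i),
    forall i, simplex (F i) & C = [set v | forall i, F i (v i)].

End Product.

Section CellAut.
Variables (X : Type) (cell : set (set X)).

Definition cellular : set (sym X) :=
  [set f | forall A : set X, cell (f @` A) <-> cell A].

Lemma cellular_group : group_closed (mem cellular).
Proof.
split=> [|f g]; rewrite !in_setE /cellular /=.
  by move=> A; rewrite image_id.
move=> cf cg A; have -> : [set (f / g) x | x in A] = f @` (g^-1 @` A).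
  by rewrite image_comp.
rewrite cf -cg image_comp (_ : g \o g^-1 = id) ?image_id //.
by apply/funext => x; apply: symVK.
Qed.

Record cell_aut := CellAut {
  cell_aut_val :> sym X;
  cell_aut_valP : cell_aut_val \in cellular }.

HB.instance Definition _ := [isSub for cell_aut_val].
HB.instance Definition _ := [Choice of cell_aut by <:].
HB.instance Definition _ :=
  SubChoice_isSubGroup.Build (sym X) (mem cellular) cell_aut cellular_group.

End CellAut.

Notation tree_aut T := (cell_aut (@simplex T)).
Notation prod_aut T := (cell_aut (@cube _ T)).

Section Actions.
Variables (G : groupType) (n : nat) (T : 'I_n -> tree).
Variable rho : {multiplicative G -> prod_aut T}.

Definition preserves_factors : Prop :=
  forall g, exists a : forall i, tree_aut (T i),
    forall (v : prod_vertex T) (i : 'I_n), rho g v i = a i (v i).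

Definition proper_action : Prop :=
  forall v : prod_vertex T, finite_set [set g : G | rho g v = v].

End Actions.

(* Main.v *)
Require Import Defs.
From HB Require Import structures.
From mathcomp Require Import all_boot all_order all_algebra.
From mathcomp Require Import boolp classical_sets cardinality.
From mathcomp Require Import zify.

(** Write H for the group, t for the shift and (i j) for transpositions.

    Proper action. H is an ascending HNN extension of the finitary permutations
    of a half-line, in two ways (one per end of Z), and acts on the product of
    the two Bass-Serre trees. A vertex of a tree is a sequence of integers that
    is eventually affine of slope 1 (resp. -1), its parent is its tail, and H
    acts by composition; an element fixing a vertex of the product fixes all
    but finitely many integers.

    No proper action. An automorphism of a product of n trees permutes the n
    directions of edges, so its n!-th power preserves factors and its 2 n!-th
    power moreover moves each coordinate by an even distance. Replacing each
    integer by a block of length 2 n! embeds H into itself, mapping t and (0 1)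
    to 2 n!-th powers; so we may assume that H preserves factors and moves
    coordinates by even distances, and consider one locally finite tree T.
    Finite subgroups of H fix a vertex, so the fixed subtree Y of (0 1) meets
    any finite number of its translates by powers of t simultaneously. If t
    fixes a vertex, its projection to Y is fixed by t; otherwise Y contains a
    ray of the axis of t. So some vertex is fixed by all the transpositions
    supported in a half-line. As T is locally finite, these act on each ball
    around that vertex through a finite group, and the pigeonhole principle
    shows that they all act in the same way. Conjugating by powers of t, the
    products (0 1)(0 m) act trivially on T, hence on the whole product, and
    vertex stabilisers are infinite. *)

Set Implicit Arguments.
Unset Strict Implicit.
Unset Printing Implicit Defensive.

(** * Distance in a tree *)

Section TreeDistance.
Variable T : tree.
Implicit Types x y z : T.
Local Open Scope nat_scope.

Definition walk n x y :=
  exists p, [/\ path (@adj T) x p, last x p = y & size p = n].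

Lemma walk_exists x y : exists n, `[< walk n x y >].
Proof.
have [p px py] := tree_connected x y.
by exists (size p); apply/asboolP; exists p.
Qed.

Definition dist x y := ex_minn (walk_exists x y).

Lemma walk_dist x y : walk (dist x y) x y.
Proof. by rewrite /dist; case: ex_minnP => n /asboolP. Qed.

Lemma dist_le_walk n x y : walk n x y -> dist x y <= n.
Proof. by rewrite /dist; case: ex_minnP => m _ min w; apply/min/asboolP. Qed.

Lemma walk_cat m n x y z : walk m x y -> walk n y z -> walk (m + n) x z.
Proof.
move=> [p [pp pl <-]] [q [qp ql <-]]; exists (p ++ q); split.
- by rewrite cat_path pp pl.
- by rewrite last_cat pl.
- by rewrite size_cat.
Qed.

Lemma walk_sym n x y : walk n x y -> walk n y x.
Proof.
move=> [p [pp <- <-]]; exists (rev (belast x p)); split.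
- by rewrite rev_path; under eq_path => u v do rewrite adj_sym.
- by case: p {pp} => //= u p; rewrite rev_cons last_rcons.
- by rewrite size_rev size_belast.
Qed.

Lemma distxx x : dist x x = 0.
Proof. by apply/eqP; rewrite -leqn0; apply: dist_le_walk; exists [::]. Qed.

Lemma dist_eq0 x y : dist x y = 0 -> x = y.
Proof. by move=> d0; have := walk_dist x y; rewrite d0 => -[[|u p] [_ ? ?]]. Qed.

Lemma distC x y : dist x y = dist y x.
Proof.
by apply/eqP; rewrite eqn_leq !dist_le_walk//; apply/walk_sym/walk_dist.
Qed.

Lemma dist_triangle x y z : dist x z <= dist x y + dist y z.
Proof. by apply: dist_le_walk; apply: walk_cat; apply: walk_dist. Qed.

Lemma adj_neq x y : adj x y -> x <> y.
Proof. by move=> + xy; rewrite xy adj_irr. Qed.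

Lemma adjP x y : adj x y <-> dist x y = 1.
Proof.
split=> [xy|d1].
  have : dist x y <= 1 by apply: dist_le_walk; exists [:: y]; rewrite /= xy.
  by case E: (dist x y) => [|[|]] // _; case: (adj_neq xy); apply: dist_eq0.
have [p [pp pl ps]] := walk_dist x y; move: pp pl ps; rewrite d1.
by case: p => [|u []] //=; rewrite andbT => + <-.
Qed.

Lemma dist_step x y : x <> y -> exists2 y', adj y y' & dist x y = (dist x y').+1.
Proof.
move=> xy; rewrite distC; have [[|y' p] [pp pl ps]] := walk_dist y x.
  by case: xy.
move: pp pl ps => /= /andP[yy' pp] pl ps; exists y' => //.
have le : dist y' x <= size p by apply: dist_le_walk; exists p.
have := dist_triangle y y' x; rewrite (proj1 (adjP _ _) yy') (distC x y').
lia.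
Qed.

(** A shortest walk from [y1] to [x] that met [y] would continue from there to [x] in fewer than
    [dist x y] steps. *)
Lemma min_walk_avoid x y y1 : adj y y1 -> dist x y1 <= dist x y ->
  exists p, [/\ path (@adj T) y1 p, last y1 p = x & y \notin y1 :: p].
Proof.
move=> yy1 le; have [p [pp pl ps]] := walk_dist y1 x.
exists p; split => //; rewrite inE negb_or; apply/andP; split.
  by apply/eqP; apply: adj_neq.
apply/negP => /splitPr def_p; case: def_p pp pl ps => p1 p2.
rewrite cat_path last_cat size_cat /= => /and3P[_ _ p2p] p2l ps.
have : dist y x <= size p2 by apply: dist_le_walk; exists p2.
by move: le; rewrite (distC x y1) (distC x y); lia.
Qed.

(** Otherwise walks from [y1] and [y2] to [x] that avoid [y] join to a simple path from [y1] to
    [y2], which [y] closes to a cycle of length at least 3. The inequalities are weak so that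
    neighbours at equal distance from [x] can be excluded as well. *)
Lemma closer_unique x y y1 y2 : adj y y1 -> adj y y2 ->
  dist x y1 <= dist x y -> dist x y2 <= dist x y -> y1 = y2.
Proof.
move=> a1 a2 /(min_walk_avoid a1)[p1 [p1p p1l p1n]].
move=> /(min_walk_avoid a2)[p2 [p2p p2l p2n]].
apply: contrapT => y12.
have [q [qp ql qn]] : exists q,
    [/\ path (@adj T) y1 q, last y1 q = y2 & y \notin y1 :: q].
  exists (p1 ++ rev (belast y2 p2)); split.
  - rewrite cat_path p1p p1l -p2l rev_path.
    by under eq_path => u v do rewrite adj_sym.
  - rewrite last_cat p1l; case: (p2) p2l => [<-//|u p p2l].
    by rewrite rev_cons last_rcons.
  - move: p1n p2n; rewrite -cat_cons mem_cat => /negbTE -> /=.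
    by rewrite mem_rev; apply: contra; apply: mem_belast.
have {ql qp} : [/\ path (@adj T) y1 (shorten y1 q), last y1 (shorten y1 q) = y2,
   uniq (y1 :: shorten y1 q) & {subset shorten y1 q <= q}].
  by case/shortenP: qp ql => q' ? ? ? ?; split.
move: (shorten y1 q) => r [rp rl ru rq].
have : ucycle (@adj T) (y :: y1 :: r).
  rewrite /ucycle cons_uniq ru andbT /= a1 rcons_path rp rl adj_sym a2 /=.
  by apply: contra qn; rewrite !inE => /orP[->//|/rq ->]; rewrite orbT.
move=> /tree_acyclic; case: r rl {rp ru rq} => //=.
Qed.

Lemma adj_dist x y y' : adj y y' ->
  dist x y' = (dist x y).+1 \/ dist x y = (dist x y').+1.
Proof.
move=> yy'; have d1 := proj1 (adjP _ _) yy'.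
have := dist_triangle x y y'; have := dist_triangle x y' y.
rewrite (distC y' y) d1 => t1 t2.
have [e|] : dist x y = dist x y' \/ dist x y <> dist x y' by lia.
  have xy : x <> y by move=> xy; move: e d1; rewrite xy distxx => <-.
  have [y2 a2 e2] := dist_step xy.
  have y2y' : y2 = y' by apply: (@closer_unique x y) => //; lia.
  by rewrite y2y' in e2; lia.
lia.
Qed.

(** A tree is bipartite: by [adj_dist], each step from [y] towards [z] changes the other two
    distances by exactly one. *)
Lemma dist_even x y z : ~~ odd (dist x y + dist y z + dist x z).
Proof.
move Dn: (dist y z) => n; elim: n z Dn => [|n IHn] z Dn.
  by rewrite (dist_eq0 Dn) addn0 addnn odd_double.
have yz : y <> z by move=> e; move: Dn; rewrite e distxx.
have [z' az' e] := dist_step yz.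
have n' : dist y z' = n by lia.
have := IHn z' n'; rewrite !oddD /=.
by case: (adj_dist x az') => -> /=; do 3![case: (odd _)].
Qed.

(** A geodesic that starts to move away from [x] never turns back, since by [closer_unique] each
    vertex has at most one neighbour that is not farther from [x]. *)
Lemma dist_concat x y z y1 : adj y y1 -> dist z y = (dist z y1).+1 ->
  dist x y1 = (dist x y).+1 -> dist x z = dist x y + dist y z.
Proof.
rewrite (distC y z); move Dn: (dist z y) => n.
elim: n y y1 Dn => [|n IHn] y y1 Dn // a1 e1 f1.
have [zy1|zy1] := pselect (z = y1); first by subst; rewrite distxx in e1; lia.
have [y2 a2 e2] := dist_step zy1.
rewrite (IHn y1 y2) //; try lia.
have [//|f2] := adj_dist x a2.
have a1' : adj y1 y by rewrite adj_sym.
have yy2 : y = y2 by apply: (@closer_unique x y1) => //; lia.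
by rewrite -yy2 in e2; lia.
Qed.

(** This is 0-hyperbolicity, from which the later geometry follows by linear arithmetic. Move [y]
    one step towards [x]: either [y] lies on the geodesic from [x] to [z] or to [w], and the
    triangle inequality suffices, or all three distances from [y] drop by one. *)
Lemma four_point x y z w :
  (dist x y + dist z w <= dist x z + dist y w) \/
  (dist x y + dist z w <= dist x w + dist y z).
Proof.
move Dn: (dist x y) => n; elim: n y Dn => [|n IHn] y Dn.
  by rewrite -(dist_eq0 Dn); have := dist_triangle z x w; rewrite (distC z x); lia.
have [zy|zy] := pselect (z = y); first by subst; rewrite distxx; lia.
have [wy|wy] := pselect (w = y).
  by subst; rewrite distxx (distC y z); lia.
have xy : x <> y by move=> e; move: Dn; rewrite e distxx.
have [y1 a1 e1] := dist_step xy.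
have n' : dist x y1 = n by lia.
have := IHn y1 n'.
have [f1|f1] := adj_dist z a1.
  have := dist_concat a1 e1 f1; have := dist_triangle z y w.
  rewrite (distC z x) (distC y x) (distC z y); lia.
have [g1|g1] := adj_dist w a1.
  have := dist_concat a1 e1 g1; have := dist_triangle z y w.
  rewrite (distC w x) (distC y x) (distC z y) (distC w y); lia.
rewrite (distC y1 z) (distC y1 w) (distC y z) (distC y w); lia.
Qed.

Lemma geodesic_point x y k : k <= dist x y ->
  exists2 c, dist x c = k & dist c y = dist x y - k.
Proof.
move Dn: (dist x y) => n; elim: n y Dn => [|n IHn] y Dn kn.
  by exists x; rewrite ?distxx ?Dn//; lia.
have [->|kn'] := eqVneq k n.+1; first by exists y; rewrite ?distxx//; lia.
have xy : x <> y by move=> e; move: Dn; rewrite e distxx.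
have [y1 a1 e1] := dist_step xy.
have [||c c1 c2] := IHn y1; try lia.
exists c => //; have := dist_triangle c y1 y; have := dist_triangle x c y.
rewrite (distC y1 y) (proj1 (adjP _ _) a1); lia.
Qed.

Lemma finite_ball x r : locally_finite T ->
  finite_set [set y | dist x y <= r]%classic.
Proof.
move=> lf; elim: r => [|r IHr].
  apply: sub_finite_set (finite_set1 x) => y /=.
  by rewrite leqn0 => /eqP/dist_eq0.
apply: sub_finite_set
  (_ : finite_set ([set x] `|` \bigcup_(z in [set y | dist x y <= r])
                                  [set y : T | adj z y])%classic).
  move=> y /= le; have [->|xy] := pselect (x = y); first by left.
  have [z yz e] := dist_step xy; right; exists z => /=; first by lia.
  by rewrite adj_sym.
rewrite finite_setU; split; first exact: finite_set1.
by apply: bigcup_finite => // z _; apply: lf.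
Qed.

End TreeDistance.

(** * Isometries of trees *)

Lemma PoszS (n : nat) : (n.+1%:Z = n%:Z + 1)%R.
Proof. lia. Qed.

Section TreeIsometries.
Variable T : tree.
Implicit Types (x y z : T) (Y : set T).
Local Open Scope nat_scope.

Definition isometry (f : T -> T) := forall x y, dist (f x) (f y) = dist x y.

Definition between x y z := dist x y + dist y z = dist x z.

Definition convex Y := forall x y z, Y x -> Y z -> between x y z -> Y y.

(** In [four_point] for [y], [f y] and the fixed ends [x], [z], both right-hand sides equal
    [dist x z], which leaves [dist y (f y) = 0]. *)
Lemma convex_fixpoints f : isometry f -> convex [set x | f x = x]%classic.
Proof.
move=> fi x y z /= fx fz xyz; apply: dist_eq0.
have := four_point y (f y) x z; have := fi y z; have := fi y x.
move: xyz; rewrite /between fx fz (distC (f y) y) (distC y x); lia.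
Qed.

(** A point [q] of [Y] nearest to [x] works: if the geodesic from [x] to some [y] in [Y] missed [q],
    its branching point from the geodesic between [q] and [y] would lie in [Y] and be nearer. *)
Lemma gate x Y y0 : convex Y -> Y y0 ->
  exists2 q, Y q & forall y, Y y -> between x q y.
Proof.
move=> cY Yy0.
have ex : exists n, `[< exists2 q, Y q & dist x q = n >].
  by exists (dist x y0); apply/asboolP; exists y0.
case: (ex_minnP ex) => n /asboolP[q Yq dq] min; exists q => // y Yy.
apply: contrapT => bad.
have := dist_triangle x q y; have := dist_triangle q x y => t1 t2.
move: bad; rewrite /between (distC q x) in t1 * => bad.
(* The Gromov product of [x] and [y] at [q], an integer by parity, is the distance from [q] to the
   branching point [c]. *)
pose k := (dist x q + dist q y - dist x y)./2.
have ek : k.*2 = dist x q + dist q y - dist x y.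
  by have := dist_even x q y; rewrite /k; lia.
have le_n : n <= dist x y by apply: min; apply/asboolP; exists y.
have [|c c1 c2] := @geodesic_point T q y k; first by lia.
have Yc : Y c by apply: cY Yq Yy _; rewrite /between; lia.
have : n <= dist x c by apply: min; apply/asboolP; exists c.
have := four_point x c q y; rewrite (distC c q); lia.
Qed.

(** * Fixed points of groups with a bounded orbit *)

Section FixedPoint.
Variables (G : groupType) (a : G -> T -> T).
Hypothesis a1 : forall x, a 1%g x = x.
Hypothesis aM : forall g h x, a (g * h)%g x = a g (a h x).
Hypothesis a_iso : forall g, isometry (a g).
Hypothesis a_even : forall g x, ~~ odd (dist x (a g x)).

(* The midpoint of a diameter of a bounded orbit is the centre of the unique
   smallest ball containing that orbit. *)
Lemma bounded_orbit_fixed (K : set G) x r :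
    K 1%g -> (forall g h, K g -> K h -> K (g^-1 * h)%g) ->
    (forall g, K g -> dist x (a g x) <= r) ->
  exists c, forall g, K g -> a g c = c.
Proof.
move=> K1 KV Kr.
have ex : exists n, `[< exists2 g, K g & dist x (a g x) = n >].
  by exists 0; apply/asboolP; exists 1%g; rewrite // a1 distxx.
have ub n : `[< exists2 g, K g & dist x (a g x) = n >] -> n <= r.
  by move=> /asboolP[g Kg <-]; apply: Kr.
case: (ex_maxnP ex ub) => D /asboolP[b Kb db] max.
have KD g h : K g -> K h -> dist (a g x) (a h x) <= D.
  move=> Kg Kh; rewrite -(a_iso g^-1%g) -!aM mulVg a1.
  by apply: max; apply/asboolP; exists (g^-1 * h)%g => //; apply: KV.
have [|c c1 c2] := @geodesic_point T x (a b x) D./2; first by rewrite db; lia.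
have evD := a_even b x.
have Kc h : K h -> dist c (a h x) <= D./2.
  move=> Kh; have := four_point c (a h x) x (a b x).
  have := KD _ _ Kh Kb; have := KD _ _ K1 Kh.
  rewrite a1 (distC c x) (distC (a h x) x); lia.
exists c => g Kg; apply: dist_eq0.
have gc h : K h -> dist (a g c) (a h x) <= D./2.
  move=> Kh; rewrite -(a_iso g^-1%g) -!aM mulVg a1.
  by apply: Kc; apply: KV.
have := four_point (a g c) c x (a b x).
have := gc _ K1; have := gc _ Kb; have := Kc _ K1; have := Kc _ Kb.
rewrite a1; lia.
Qed.

End FixedPoint.

(** * Axes of translations *)

Section Translations.
Variable s : int -> T -> T.
Hypothesis s0 : forall x, s 0 x = x.
Hypothesis sD : forall i j x, s (i + j)%R x = s i (s j x).
Hypothesis s_iso : forall i, isometry (s i).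
Hypothesis s_even : forall i x, ~~ odd (dist x (s i x)).

(** The gate [q] of [x] in [Y] lies on the geodesic from [x] to [s 1 z], and so does [s 1 q], at the
    same distance from the fixed point [x]. *)
Lemma elliptic_fixed Y x : convex Y -> s 1 x = x ->
    (exists2 z, Y z & Y (s 1 z)) ->
  exists2 q, Y q & s 1 q = q.
Proof.
move=> cY sx [z Yz Ysz]; have [q Yq gq] := gate x cY Yz.
exists q => //; apply: dist_eq0.
have := four_point (s 1 q) q x (s 1 z); have := gq _ Yz; have := gq _ Ysz.
have := s_iso 1 x q; have := s_iso 1 x z; have := s_iso 1 q z.
rewrite sx /between (distC (s 1 q) x) (distC q x); lia.
Qed.

Section Axis.
Variable x : T.
Hypothesis x_min : forall y, dist x (s 1 x) <= dist y (s 1 y).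
Hypothesis x_move : s 1 x <> x.
Let d := dist x (s 1 x).

Lemma axis_d : 2 <= d.
Proof.
have := s_even 1 x; rewrite -/d; case E: d => [|[|]]//.
by case: x_move; apply: dist_eq0; rewrite distC.
Qed.

(** If the path through [x], [s 1 x], [s 2 x] folded at its middle, the neighbour [y] of [x] on the
    way to [s 1 x] would be displaced by less than the minimum [d]. *)
Lemma axis2 : dist x (s 2 x) = d + d.
Proof.
have d2 := axis_d.
have e2 : s 2 x = s 1 (s 1 x) by rewrite -sD.
have ub := dist_triangle x (s 1 x) (s 2 x).
have d12 : dist (s 1 x) (s 2 x) = d by rewrite e2 s_iso.
have [|y y1 y2] := @geodesic_point T x (s 1 x) 1; first by rewrite -/d; lia.
rewrite -/d in y2 ub.
have sy1 : dist (s 1 x) (s 1 y) = 1 by rewrite s_iso.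
have sy2 : dist (s 1 y) (s 2 x) = d - 1 by rewrite e2 s_iso.
have min := x_min y; rewrite -/d in min.
have q1 := four_point x (s 1 y) (s 1 x) (s 2 x).
have q2 := four_point y (s 1 y) x (s 1 x).
rewrite -/d in q1 q2.
move: q1 q2; rewrite (distC (s 1 y) (s 1 x)) (distC y x) (distC (s 1 y) x).
lia.
Qed.

(** A path without folding is geodesic: [four_point] extends the case of two consecutive steps to
    all lengths. *)
Lemma axis_dist (i : int) (n : nat) : dist (s i x) (s (i + n%:Z)%R x) = n * d.
Proof.
rewrite sD s_iso; elim/ltn_ind: n => -[|[|n]] IHn; rewrite ?mul1n//.
  by rewrite s0 distxx.
have d2 := axis_d.
have e1 : dist x (s n x) = n * d by apply: IHn; lia.
have e2 : dist x (s n.+1 x) = n.+1 * d by apply: IHn; lia.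
have e3 : dist (s n x) (s n.+1 x) = d.
  by rewrite PoszS sD s_iso.
have e4 : dist (s n.+1 x) (s n.+2 x) = d.
  by rewrite (PoszS n.+1) sD s_iso.
have e5 : dist (s n x) (s n.+2 x) = d + d.
  by rewrite -[n.+2]addn2 PoszD sD s_iso axis2.
have := four_point x (s n.+1 x) (s n x) (s n.+2 x).
have := dist_triangle x (s n.+1 x) (s n.+2 x).
rewrite (distC (s n.+1 x) (s n x)); lia.
Qed.

(** Once a step along the axis does not approach [z], the projection of [z] to the axis has been
    passed, and each further step adds its full length [d]. *)
Lemma axis_up z (i : int) : dist z (s i x) <= dist z (s (i + 1)%R x) ->
  forall n : nat, dist z (s (i + 1 + n%:Z)%R x) = dist z (s (i + 1)%R x) + n * d.
Proof.
move=> le n; have d2 := axis_d.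
have := axis_dist (i + 1)%R n.
have : dist (s i x) (s (i + 1)%R x) = 1 * d := axis_dist i 1.
have := axis_dist i n.+1.
rewrite (_ : (i + n.+1%:Z)%R = (i + 1 + n%:Z)%R); last lia.
have := dist_triangle z (s (i + 1)%R x) (s (i + 1 + n%:Z)%R x).
have := four_point z (s (i + 1)%R x) (s i x) (s (i + 1 + n%:Z)%R x).
rewrite (distC (s (i + 1)%R x) (s i x)); lia.
Qed.

Lemma axis_down z (i : int) : dist z (s i x) <= dist z (s (i - 1)%R x) ->
  forall n : nat, dist z (s (i - 1 - n%:Z)%R x) = dist z (s (i - 1)%R x) + n * d.
Proof.
move=> le n; have d2 := axis_d.
have := axis_dist (i - 1 - n%:Z)%R n; rewrite GRing.subrK.
have := axis_dist (i - 1)%R 1; rewrite GRing.subrK.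
have := axis_dist (i - 1 - n%:Z)%R n.+1.
rewrite (_ : (i - 1 - n%:Z + n.+1%:Z)%R = i); last lia.
have := dist_triangle z (s (i - 1)%R x) (s (i - 1 - n%:Z)%R x).
have := four_point z (s (i - 1)%R x) (s i x) (s (i - 1 - n%:Z)%R x).
move: le; rewrite !(distC _ (s (i - 1 - n%:Z)%R x)).
rewrite !(distC _ (s (i - 1)%R x)); lia.
Qed.

(** Let [s i0 x] be the orbit point nearest to [z]. The projection of [z] to the axis is less than
    one step from it, so the geodesic from [z] to its translate by [n.+3] runs along the axis
    through the points of index [i0 + 1] to [i0 + n.+2]. *)
Lemma axis_between z (n : nat) : exists i : int, forall k : nat, k <= n.+1 ->
  between z (s (i + k%:Z)%R x) (s (n.+3)%:Z z).
Proof.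
have d2 := axis_d.
have ex : exists m, `[< exists i, dist z (s i x) = m >].
  by exists (dist z (s 0 x)); apply/asboolP; exists 0%R.
case: (ex_minnP ex) => m /asboolP[i0 di0] min.
have {}min i : m <= dist z (s i x) by apply: min; apply/asboolP; exists i.
have up := @axis_up z i0; rewrite di0 in up; have {}up := up (min _).
have down := @axis_down z i0; rewrite di0 in down; have {}down := down (min _).
exists (i0 + 1)%R => k kn.
have far j : j <= n.+1 -> dist (s (n.+3)%:Z z) (s (i0 + 1 + j%:Z)%R x) =
    dist z (s (i0 - 1)%R x) + (n.+1 - j) * d.
  move=> jn; rewrite -down -(s_iso (- (n.+3)%:Z)%R) -!sD GRing.addNr s0.
  by congr (dist z (s _ x)); lia.
have := four_point z (s (i0 + 1 + n.+1%:Z)%R x)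
  (s (n.+3)%:Z z) (s (i0 + 1)%R x).
rewrite !(distC (s (i0 + 1 + n.+1%:Z)%R x)).
have := up n.+1; have := up k; have := far _ kn; have := far n.+1 (leqnn _).
have := far 0 isT; have := axis_dist (i0 + 1)%R n.+1.
have := dist_triangle z (s (i0 + 1 + k%:Z)%R x) (s (n.+3)%:Z z).
rewrite GRing.addr0 subn0 subnn mul0n /between mulnBl.
rewrite (distC (s (n.+3)%:Z z) (s (i0 + 1 + k%:Z)%R x)).
have : k * d <= n.+1 * d by rewrite leq_mul2r kn orbT.
move: (k * d) => kd; rewrite mulSn; move: (n * d) => nd; lia.
Qed.

End Axis.

(** Take [x] of minimal displacement. If [x] is fixed, [elliptic_fixed] applies. Otherwise [Y]
    contains arbitrarily long segments of the orbit on the axis, and by convexity the indices of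
    orbit points in [Y] form an interval, hence contain a half-line. *)
Lemma ray_in_convex Y : convex Y ->
    (forall n : nat, exists z, forall j : nat, j <= n -> Y (s j%:Z z)) ->
  exists x, (forall j : nat, Y (s j%:Z x)) \/
            (forall j : nat, Y (s (- j%:Z)%R x)).
Proof.
move=> cY inter.
have [x0 _] := inter 0.
have ex : exists m, `[< exists x, dist x (s 1 x) = m >].
  by exists (dist x0 (s 1 x0)); apply/asboolP; exists x0.
case: (ex_minnP ex) => m /asboolP[x dx] min.
have {ex}min y : dist x (s 1 x) <= dist y (s 1 y).
  by rewrite dx; apply: min; apply/asboolP; exists y.
have [sx|sx] := pselect (s 1 x = x).
  have [z zY] := inter 1.
  have [|q Yq sq] := elliptic_fixed cY sx.
    by exists z; [rewrite -(s0 z); apply: (zY 0) | apply: (zY 1)].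
  exists q; left; elim=> [|j IHj]; first by rewrite s0.
  by rewrite PoszS sD sq.
have longJ (n : nat) : exists i : int,
    forall k : nat, k <= n.+1 -> Y (s (i + k%:Z)%R x).
  have [z zY] := inter n.+3; have [i bi] := axis_between min sx z n.
  exists i => k /bi; apply: cY (zY n.+3 (leqnn _)).
  by rewrite -(s0 z); apply: (zY 0).
have convJ (i : int) (k l : nat) : Y (s i x) -> Y (s (i + k%:Z + l%:Z)%R x) ->
    Y (s (i + k%:Z)%R x).
  move=> Yi Yl; apply: cY Yi Yl _; rewrite /between.
  rewrite !(axis_dist min sx).
  rewrite (_ : i + k%:Z + l%:Z = i + (k + l)%N%:Z)%R; last lia.
  by rewrite (axis_dist min sx); lia.
have [i0 /(_ 0 isT)] := longJ 0; rewrite GRing.addr0 => Yi0.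
exists (s i0 x).
have [up|] := pselect (forall j : nat, Y (s (i0 + j%:Z)%R x)).
  by left=> j; rewrite -sD GRing.addrC; apply: up.
(* If the index [i0 + M] is missing, every segment in [Y] ends before it, so long segments must
   reach far below [i0]. *)
move=> /existsNP[M nM]; right=> j; rewrite -sD GRing.addrC.
have [i iY] := longJ (M + j).
have ub (k : nat) : Y (s (i0 + k%:Z)%R x) -> k < M.
  move=> Yk; rewrite ltnNge; apply/negP => Mk; apply: nM.
  apply: (@convJ _ _ (k - M)) => //.
  by rewrite (_ : i0 + _ + _ = i0 + k%:Z)%R //; lia.
have top := iY _ (leqnn _).
have le : (i + (M + j).+1%:Z < i0 + M%:Z)%R.
  have [lt0|ge0] : (i + (M + j).+1%:Z < i0 \/ i0 <= i + (M + j).+1%:Z)%R by lia.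
    by lia.
  have := ub (absz (i + (M + j).+1%:Z - i0)%R).
  rewrite (_ : (i0 + _)%R = i + (M + j).+1%:Z)%R; last by lia.
  by move=> /(_ top); lia.
have Yi := iY 0 isT; rewrite GRing.addr0 in Yi.
have := @convJ i (absz (i0 - j%:Z - i)%R) j Yi.
rewrite (_ : i + absz (i0 - j%:Z - i)%R = i0 - j%:Z)%R; last lia.
by rewrite GRing.subrK; apply.
Qed.

End Translations.

End TreeIsometries.

(** * Automorphisms of products of trees *)

Section ProductOfTrees.
Variables (n : nat) (T : 'I_n -> tree).
Implicit Types (u v w : prod_vertex T) (i j k : 'I_n) (f g : prod_aut T).
Local Open Scope classical_set_scope.
Local Open Scope group_scope.

Definition edge i v w := adj (v i) (w i) /\ forall k, k <> i -> v k = w k.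

Lemma edge_sym i v w : edge i v w -> edge i w v.
Proof. by move=> [vw e]; split=> [|k /e//]; rewrite adj_sym. Qed.

Lemma edge_direction i j v w : edge i v w -> edge j v w -> i = j.
Proof.
by move=> [/adj_neq vw _] [_ e]; apply: contrapT => /e.
Qed.

Lemma edge_neq i v w : edge i v w -> v <> w.
Proof. by move=> [/adj_neq vw _] e; apply: vw; rewrite e. Qed.

Lemma vertex_eq v w : (forall k, v k = w k) -> v = w.
Proof. exact: functional_extensionality_dep. Qed.

Lemma simplex_set2 (S : tree) (x y : S) : x = y \/ adj x y -> simplex [set x; y].
Proof.
by case=> [->|xy]; [left; exists y; rewrite setUid | right; exists x, y].
Qed.

Lemma simplex_adj (S : tree) (A : set S) x y :
  simplex A -> A x -> A y -> x <> y -> adj x y.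
Proof.
move=> [[z ->] -> -> //|[z [z' [zz' ->]]]].
by case=> -> [] -> // _; rewrite adj_sym.
Qed.

Lemma simplex_le2 (S : tree) (A : set S) x y z :
  simplex A -> A x -> A y -> A z -> x <> y -> x <> z -> y = z.
Proof.
move=> [[u ->] -> -> //|[u [u' [_ ->]]]].
by case=> -> [] -> [] ->.
Qed.

Lemma edge_cube i v w : edge i v w -> cube [set v; w].
Proof.
move=> [vw e]; exists (fun k => [set v k; w k]) => [k|].
  apply: simplex_set2; have [->|ki] := eqVneq k i; first by right.
  by left; apply/e/eqP.
apply/seteqP; split=> u /=; first by case=> -> k; [left | right].
move=> uk; have [ui|ui] := uk i; [left | right]; apply: vertex_eq => k;
  have [->//|/eqP ki] := eqVneq k i; by have := uk k; rewrite (e k ki) => -[].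
Qed.

Lemma cube_edge v w : v <> w -> cube [set v; w] -> exists i, edge i v w.
Proof.
move=> vw [F Fs C].
have Fv k : F k (v k) by have : [set v; w] v by [left]; rewrite C; apply.
have Fw k : F k (w k) by have : [set v; w] w by [right]; rewrite C; apply.
have [i vwi] : exists i, v i <> w i.
  by apply: contrapT => /forallNP e; apply/vw/vertex_eq => k; apply: contrapT.
exists i; split=> [|k ki]; first exact: simplex_adj (Fs i) _ _ vwi.
pose u j := if j == i then w j else v j.
have : [set v; w] u by rewrite C => j; rewrite /u; case: ifP.
case=> e; first by case: vwi; rewrite -e /u eqxx.
by rewrite -e /u; move/eqP/negbTE: ki => ->.
Qed.

(** The fourth corner of the square spanned at [v] by an edge to [w] in direction [i] and an edge to
    [w'] in another direction. *)
Definition opposite i v w w' : prod_vertex T :=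
  fun k => if k == i then w k else w' k.

Definition square i v w w' : set (prod_vertex T) :=
  [set u | [\/ u = v, u = w, u = w' | u = opposite i v w w']].

Lemma square_cube i j v w w' : i <> j -> edge i v w -> edge j v w' ->
  cube (square i v w w').
Proof.
move=> ij [vw e] [vw' e'].
exists (fun k => [set v k; opposite i v w w' k]) => [k|].
  apply: simplex_set2; rewrite /opposite.
  have [->|/eqP ki] := eqVneq k i; first by right.
  have [->|/eqP kj] := eqVneq k j; first by right.
  by left; apply: e'.
have ji : (j == i) = false by apply/eqP => /esym.
apply/seteqP; split=> u /=.
  case=> -> k; rewrite /opposite.
  - by left.
  - by have [->|/eqP ki] := eqVneq k i; [right | left; rewrite (e k ki)].
  - have [->|/eqP ki] := eqVneq k i; last by right.
    by left; rewrite e'.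
  - by right.
move=> uk.
have other k : k <> i -> k <> j -> u k = v k.
  move=> ki kj; have := uk k; rewrite /opposite; move/eqP/negbTE: ki => ->.
  by rewrite (e' k kj) => -[].
have := uk i; have := uk j; rewrite /opposite eqxx ji.
case=> uj [] ui; [apply: Or41 | apply: Or42 | apply: Or43 | apply: Or44];
  apply: vertex_eq => k; rewrite /opposite;
  (have [->|/eqP ki] := eqVneq k i;
    [by rewrite ?ui ?e' | have [->|/eqP kj] := eqVneq k j]);
  by rewrite ?uj ?other // -?e -?e' //; apply/nesym.
Qed.

Lemma cube_image f (C : set (prod_vertex T)) : cube (f @` C) <-> cube C.
Proof. by have /set_mem := cell_aut_valP f; apply. Qed.

Lemma prod_autM f g v : (f * g) v = f (g v). Proof. by []. Qed.
Lemma prod_autK f v : f^-1 (f v) = v. Proof. exact: symK. Qed.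
Lemma prod_autVK f v : f (f^-1 v) = v. Proof. exact: symVK. Qed.

Lemma prod_aut_inj f : injective f.
Proof. exact: can_inj (prod_autK f). Qed.

Lemma aut_edge f i v w : edge i v w -> exists j, edge j (f v) (f w).
Proof.
move=> vw; apply: cube_edge; first by move/prod_aut_inj; apply: edge_neq vw.
have := proj2 (cube_image f _) (edge_cube vw).
by rewrite image_setU !image_set1.
Qed.

(** The two edges span a square. If their images were parallel, [f v], [f w] and [f w'] would differ
    only in coordinate [j], where the image cube has at most two vertices. *)
Lemma aut_square_neq f i i' j j' v w w' : i <> i' ->
    edge i v w -> edge i' v w' -> edge j (f v) (f w) -> edge j' (f v) (f w') ->
  j <> j'.
Proof.
move=> ii' vw vw' fvw fvw' jj'; subst j'.
have [F Fs C] := proj2 (cube_image f _) (square_cube ii' vw vw').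
have inF u : square i v w w' u -> F j (f u j).
  move=> hu; have : (f @` square i v w w') (f u) by exists u.
  by rewrite C => /(_ j).
have fw : f w = f w'.
  apply: vertex_eq => k; have [->|/eqP kj] := eqVneq k j.
    apply: (@simplex_le2 _ (F j) (f v j)) => //; try apply: inF.
    - exact: Or41.
    - exact: Or42.
    - exact: Or43.
    - exact: adj_neq fvw.1.
    - exact: adj_neq fvw'.1.
  by rewrite -(fvw.2 k kj) (fvw'.2 k kj).
by apply: ii'; move/prod_aut_inj: fw vw vw' => ->; apply: edge_direction.
Qed.

Lemma aut_same_direction f i j j' v w w' :
    edge i v w -> edge i v w' -> edge j (f v) (f w) -> edge j' (f v) (f w') ->
  j = j'.
Proof.
move=> vw vw' fvw fvw'; apply: contrapT => jj'.
by have := @aut_square_neq f^-1 j j' i i (f v) (f w) (f w') jj' fvw fvw';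
  rewrite !prod_autK => /(_ vw vw').
Qed.

(** The image cube contains the vertex [u'] across from [f w'] in direction [j]; among the four
    corners of the square, only the opposite one can map to it. *)
Lemma aut_parallel f i i' j v w w' : i <> i' ->
    edge i v w -> edge i' v w' -> edge j (f v) (f w) ->
  edge j (f w') (f (opposite i v w w')).
Proof.
move=> ii' vw vw' fvw; have [j' fvw'] := aut_edge f vw'.
have jj' := aut_square_neq ii' vw vw' fvw fvw'.
have [F Fs C] := proj2 (cube_image f _) (square_cube ii' vw vw').
have inF u : square i v w w' u ->
    forall k, F k (f u k).
  move=> hu k; have : (f @` square i v w w') (f u) by exists u.
  by rewrite C => /(_ k).
pose u' k := if k == j then f w k else f w' k.
have : [set v | forall k, F k (v k)] u'.
  move=> k; rewrite /u'; case: ifP => _; apply: inF; [exact: Or42 | exact: Or43].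
have j'j : (j' == j) = false by apply/eqP => /esym.
have u'j : u' j = f w j by rewrite /u' eqxx.
have u'j' : u' j' = f w' j' by rewrite /u' j'j.
have fwj' : f w j' = f v j' by rewrite -fvw.2 //; apply/nesym.
have fw'j : f w' j = f v j by rewrite -fvw'.2.
rewrite -C => -[z hz fz]; case: hz => hz; subst z.
- by case: (adj_neq fvw.1); rewrite fz u'j.
- by case: (adj_neq fvw'.1); rewrite -u'j' -fz fwj'.
- by case: (adj_neq fvw.1); rewrite -u'j -fz fw'j.
rewrite fz; split=> [|k kj]; first by rewrite u'j fw'j; apply: fvw.1.
by rewrite /u'; move/eqP/negbTE: kj => ->.
Qed.

Definition maps_direction f i j := forall v w, edge i v w -> edge j (f v) (f w).

(** The coordinates are changed one after the other, each along a path in its tree. *)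
Lemma connect_coordinates (D : pred 'I_n) (P : prod_vertex T -> Prop) v w :
    (forall k u u', D k -> edge k u u' -> P u -> P u') ->
    (forall k, ~~ D k -> v k = w k) ->
  P v -> P w.
Proof.
move=> step vw Pv.
have update k u (x : T k) : D k -> P u -> P (dfwith u x).
  move=> Dk Pu; have [p pp <-] := tree_connected (u k) x.
  have : P (dfwith u (u k)).
    rewrite (_ : dfwith u (u k) = u) //; apply: vertex_eq => j.
    by case: dfwithP.
  elim: p (u k) pp => //= y p IHp z /andP[zy pp] Pz.
  apply: IHp => //; apply: step Dk _ Pz; split; first by rewrite !dfwith_in.
  by move=> j jk; rewrite !dfwith_out //; apply/eqP/nesym.
suff : forall s : seq 'I_n, P (fun k => if k \in s then w k else v k).
  move=> /(_ (enum 'I_n)); congr P; apply: vertex_eq => k.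
  by rewrite mem_enum.
elim=> [|k s IHs].
  by rewrite (_ : (fun k => _) = v).
have [Dk|Dk] := boolP (D k).
  have := update k _ (w k) Dk IHs; congr P; apply: vertex_eq => j.
  rewrite inE; have [->|jk] := eqVneq j k; first by rewrite dfwith_in.
  by rewrite dfwith_out // eq_sym.
move: IHs; congr P; apply: vertex_eq => j; rewrite inE.
by have [->|//] := eqVneq j k; rewrite vw //=; case: ifP.
Qed.

(** The image direction of [i]-edges is carried from vertex to vertex: along [i]-edges by
    [aut_same_direction], along all others by [aut_parallel]. *)
Lemma aut_maps_direction f i j v w : edge i v w -> edge j (f v) (f w) ->
  maps_direction f i j.
Proof.
move=> vw fvw v'; pose P u := forall w', edge i u w' -> edge j (f u) (f w').
suff : P v' by [].
apply: (@connect_coordinates predT P v) => //; last first.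
  move=> w' vw'; have [j' fvw'] := aut_edge f vw'.
  by rewrite (aut_same_direction vw vw' fvw fvw').
move=> k u u' _ uu' Pu w' uw'; have [ki|ki] := eqVneq k i.
  subst k; have [j' fuw'] := aut_edge f uw'.
  by rewrite (aut_same_direction (edge_sym uu') uw' (edge_sym (Pu _ uu')) fuw').
pose w0 : prod_vertex T := fun l => if l == i then w' l else u l.
have ik : i <> k by apply/nesym/eqP.
have uw0 : edge i u w0.
  split=> [|l li]; rewrite /w0 ?eqxx; last by move/eqP/negbTE: li => ->.
  by rewrite (uu'.2 i ik); apply: uw'.1.
have := aut_parallel ik uw0 uu' (Pu _ uw0); congr (edge j _ (f _)).
apply: vertex_eq => l; rewrite /opposite /w0.
by have [//|/eqP li] := eqVneq l i; apply: uw'.2.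
Qed.

Lemma maps_directionM f g i j k :
  maps_direction g i j -> maps_direction f j k -> maps_direction (f * g) i k.
Proof. by move=> gij fjk v w /gij/fjk. Qed.

Definition nontrivial i := exists v w, edge i v w.

Lemma nontrivial_edge i v : nontrivial i -> exists w, edge i v w.
Proof.
move=> [u [u' [uu' _]]].
have [x vx] : exists x : T i, v i <> x.
  have [e|] := pselect (v i = u i); last by exists (u i).
  by exists (u' i); rewrite e; apply: adj_neq.
have [y vy _] := dist_step (nesym vx); exists (dfwith v y); split.
  by rewrite dfwith_in.
by move=> k ki; rewrite dfwith_out //; apply/eqP/nesym.
Qed.

Lemma aut_permutes_directions f :
  exists2 s : 'I_n -> 'I_n, injective s & forall i, maps_direction f i (s i).
Proof.
(* A factor with a single vertex has no edges, and any [j] would do; [j = i] is imposed there to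
   make [s] injective. *)
have /choice[s sP] : forall i, exists j, maps_direction f i j /\
    (~ nontrivial i -> j = i).
  move=> i; have [[v [w vw]]|tr] := pselect (nontrivial i).
    have [j fvw] := aut_edge f vw; exists j; split; last by case; exists v, w.
    exact: aut_maps_direction vw fvw.
  by exists i; split=> // v w vw; case: tr; exists v, w.
have nts i : nontrivial i -> nontrivial (s i).
  by move=> [v [w /(sP i).1 fvw]]; exists (f v), (f w).
have sI : injective s.
  move=> i i' e; have [nti|tri] := pselect (nontrivial i); last first.
    have [nti'|tri'] := pselect (nontrivial i'); last first.
      by rewrite -((sP i).2 tri) -((sP i').2 tri').
    by case: (tri); rewrite -((sP i).2 tri) e; apply: nts.
  have [nti'|tri'] := pselect (nontrivial i'); last first.
    by case: (tri'); rewrite -((sP i').2 tri') -e; apply: nts.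
  apply: contrapT => ii'; have [v _] := nti.
  have [w vw] := nontrivial_edge v nti; have [w' vw'] := nontrivial_edge v nti'.
  by have := aut_square_neq ii' vw vw' ((sP i).1 _ _ vw) ((sP i').1 _ _ vw').
by exists s => // i; apply: (sP i).1.
Qed.

(** * Automorphisms that preserve factors and move coordinates by even distances *)

Definition factorwise f := forall i, maps_direction f i i.

Lemma factorwise_exp f : factorwise (f ^+ n`!).
Proof.
have [s sI fs] := aut_permutes_directions f.
have fX m i : maps_direction (f ^+ m) i (iter m s i).
  elim: m => [|m IHm] /=; first by rewrite expg0 => v w.
  by rewrite expgS; apply: maps_directionM IHm (fs _).
move=> i; have /dvdnP[q e] : order s i %| n`!.
  by rewrite dvdn_fact // order_gt0 -[n in (_ <= n)%N]card_ord max_card.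
have := fX n`! i; suff -> : iter n`! s i = i by [].
by rewrite e; elim: q {e} => //= q IHq; rewrite iterD IHq iter_order.
Qed.

Lemma factorwise1 : factorwise 1. Proof. by move=> i v w vw. Qed.

Lemma factorwiseM f g : factorwise f -> factorwise g -> factorwise (f * g).
Proof. by move=> ff fg i; apply: maps_directionM (fg i) (ff i). Qed.

Lemma factorwiseV f : factorwise f -> factorwise f^-1.
Proof.
move=> ff i v w vw; have [j fvw] := aut_edge f^-1 vw.
have := ff j _ _ fvw; rewrite !prod_autVK => vw'.
by rewrite (edge_direction vw vw').
Qed.

(** Moves in the other directions do not affect coordinate [i] of the image, so [f] induces a map on
    each tree. *)
Lemma factorwise_coordinate f v w i : factorwise f -> v i = w i -> f v i = f w i.
Proof.
move=> ff vwi.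
apply: (@connect_coordinates (predC1 i) (fun u => f v i = f u i) v w) => //.
  move=> k u u' /= ki uu' ->; apply: (ff k _ _ uu').2.
  by apply/nesym/eqP.
by move=> k /=; rewrite negbK => /eqP ->.
Qed.

Lemma factorwise_dist_le f v w i : factorwise f ->
  (dist (f v i) (f w i) <= dist (v i) (w i))%N.
Proof.
move=> ff; move Dm: (dist (v i) (w i)) => m; elim: m w Dm => [|m IHm] w Dm.
  by rewrite (factorwise_coordinate ff (dist_eq0 Dm)) distxx.
have vw : v i <> w i by move=> e; move: Dm; rewrite e distxx.
have [y wy e] := dist_step vw.
have ww' : edge i w (dfwith w y).
  split=> [|k ki]; first by rewrite dfwith_in.
  by rewrite dfwith_out //; apply/eqP/nesym.
have := IHm (dfwith w y); rewrite dfwith_in.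
have /adjP := (ff i _ _ ww').1.
have := dist_triangle (f v i) (f (dfwith w y) i) (f w i).
rewrite (distC (f (dfwith w y) i)) => t d1 /(_ _); lia.
Qed.

Lemma factorwise_dist f v w i : factorwise f ->
  dist (f v i) (f w i) = dist (v i) (w i).
Proof.
move=> ff; apply/eqP; rewrite eqn_leq factorwise_dist_le //=.
have := factorwise_dist_le (f v) (f w) i (factorwiseV ff).
by rewrite !prod_autK.
Qed.

Definition even_aut : set (prod_aut T) :=
  [set f | factorwise f /\ forall v i, ~~ odd (dist (v i) (f v i))].

Lemma even_aut_group : group_closed (mem even_aut).
Proof.
split=> [|f g /set_mem[ff ef] /set_mem[fg eg]]; apply/mem_set; split.
- exact: factorwise1.
- by move=> v i; rewrite distxx.
- exact: factorwiseM (factorwiseV fg).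
move=> v i; have := eg (g^-1 v) i; have := ef (g^-1 v) i.
have := dist_even (v i) (g^-1 v i) ((f / g) v i).
rewrite prod_autVK (distC (g^-1 v i) (v i)) prod_autM; lia.
Qed.

(** Both steps, from [v] to [f v] and on to its image, have the same length in each coordinate, so
    their sum is even. *)
Lemma even_aut_sqr f : factorwise f -> even_aut (f ^+ 2).
Proof.
move=> ff; split; first by rewrite expg2; apply: factorwiseM.
move=> v i; have := dist_even (v i) (f v i) ((f ^+ 2) v i).
by rewrite expg2 prod_autM (factorwise_dist _ _ _ ff); lia.
Qed.

End ProductOfTrees.

(** * Transpositions and translations in the Houghton group *)

Import GRing.Theory Num.Theory.

Section SymmetricGroup.
Variable X : eqType.
Local Open Scope group_scope.
Implicit Types (g h : sym X) (x y : X).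

Lemma sym_inj g : injective g.
Proof. exact: can_inj (@symK X g). Qed.

Lemma symKV g x : g^-1 (g x) = x. Proof. exact: symK. Qed.
Lemma symVKV g x : g (g^-1 x) = x. Proof. exact: symVK. Qed.

Definition swap_fun x y z := if z == x then y else if z == y then x else z.

Lemma swap_funK x y : involutive (swap_fun x y).
Proof.
move=> z; rewrite /swap_fun; case: (eqVneq z x) => [->|zx].
  by case: (eqVneq y x) => [//|yx]; rewrite eqxx.
by case: (eqVneq z y) => [->|zy]; rewrite ?eqxx// (negbTE zx) (negbTE zy).
Qed.

Definition swap x y : sym X := Sym (swap_funK x y) (swap_funK x y).

Lemma swapE x y z : swap x y z = if z == x then y else if z == y then x else z.
Proof. by []. Qed.

Lemma swapV x y : (swap x y)^-1 = swap x y.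
Proof. exact: sym_eqP. Qed.

Lemma swap_conj g x y : g * swap x y * g^-1 = swap (g x) (g y).
Proof.
apply: sym_eqP => z; rewrite !symME !swapE.
rewrite -(inj_eq (@sym_inj g)) -(inj_eq (@sym_inj g) _ y) symVKV.
by case: eqP => // _; case: eqP => // _; rewrite symVKV.
Qed.

Lemma swapC x y : swap x y = swap y x.
Proof.
apply: sym_eqP => z; rewrite !swapE.
by case: eqVneq => [->|//]; case: eqVneq.
Qed.

Lemma FSym_swap x y : FSym (swap x y).
Proof.
apply: sub_finite_set (finite_set2 x y) => z /=; rewrite /swap_fun.
by case: eqVneq => [->|_]; [left | case: eqVneq => [->|//]; right].
Qed.

(** Multiplying [g] on the left by [swap x (g x)] makes it fix [x] and keeps its other fixed points,
    so the support can be emptied point by point. *)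
Lemma swap_generate (B : set (sym X)) g : group_closed (mem B) ->
  (forall x y, B (swap x y)) -> FSym g -> B g.
Proof.
move=> BG Bsw; rewrite /FSym /= => /finite_seqP[s fs].
have : forall x, x \notin s -> g x = x.
  move=> x; apply: contraNP => gx.
  by have : [set x | g x <> x]%classic x by []; rewrite fs.
have B1 : B 1 by apply/set_mem/BG.1.
have BM g1 g2 : B g1 -> B g2 -> B (g1 * g2).
  by move=> b1 b2; apply/set_mem/(group_closedM BG); apply/mem_set.
elim: s g {fs} => [|x s IHs] g gs.
  by rewrite (_ : g = 1) //; apply: sym_eqP => x; apply: gs.
have -> : g = swap x (g x) * (swap x (g x) * g).
  by rewrite mulgA -{1}[swap _ _]swapV mulVg mul1g.
apply: BM => //; apply: IHs => y ys; rewrite symME swapE.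
case: (eqVneq y x) => [->|yx].
  by case: eqVneq => // e; rewrite eqxx.
have gy : g y = y by apply: gs; rewrite inE negb_or yx.
rewrite gy (negbTE yx); case: eqVneq => // e.
by case/eqP: yx; apply: (@sym_inj g); rewrite gy.
Qed.

Lemma finite_supported (s : seq X) :
  finite_set [set g : sym X | forall x, x \notin s -> g x = x]%classic.
Proof.
set A := (X in finite_set X).
(* [g] is encoded by the indices of its values on [s]. The default [ord_max] is never reached, as an
   index is at most [size s]. *)
pose f g := [ffun i : 'I_(size s) =>
  insubd (@ord_max (size s)) (index (g (tnth (in_tuple s) i)) s)].
suff fI : {in A &, injective f}.
  by rewrite -(eq_finite_set (inj_card_eq fI)); apply: finite_finset.
move=> g h /set_mem gA /set_mem hA /ffunP fgh; apply: sym_eqP => x.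
have [xs|xs] := boolP (x \in s); last by rewrite gA ?hA.
have stab k : A k -> k x \in s.
  move=> kA; apply: contraT => nks.
  by move: (nks); rewrite (sym_inj (kA _ nks)) xs.
have ix : (index x s < size s)%N by rewrite index_mem.
have := fgh (Ordinal ix); rewrite !ffunE (tnth_nth x) /= nth_index //.
move=> /(congr1 val); rewrite !val_insubd !ltnS !index_size => e.
by rewrite -(nth_index x (stab g gA)) e nth_index // stab.
Qed.

End SymmetricGroup.

(** * Elements and generators of the Houghton group *)

Section Houghton2.
Local Open Scope group_scope.

Lemma translationK (n : int) : cancel (fun k : int => k + n)%R (fun k => k - n)%R.
Proof. by move=> k; rewrite addrK. Qed.

Lemma translationVK (n : int) : cancel (fun k : int => k - n)%R (fun k => k + n)%R.
Proof. by move=> k; rewrite subrK. Qed.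

Definition translation n : sym int := Sym (translationK n) (translationVK n).

Lemma translationD m n : translation (m + n)%R = translation m * translation n.
Proof. by apply: sym_eqP => k; rewrite symME /=; lia. Qed.

Lemma translation0 : translation 0%R = 1.
Proof. by apply: sym_eqP => k; rewrite /= addr0. Qed.

Lemma translationN n : translation (- n)%R = (translation n)^-1.
Proof. by apply: sym_eqP. Qed.

Lemma translation_shift : translation (-1)%R = shift.
Proof. by apply: sym_eqP. Qed.

Lemma translation_generate (B : set (sym int)) n :
  group_closed (mem B) -> B shift -> B (translation n).
Proof.
move=> BG Bs; have nat_case (m : nat) : B (translation (- m%:Z)%R).
  elim: m => [|m IHm].
    by rewrite oppr0 translation0; apply/set_mem/BG.1.
  rewrite (_ : - _ = -1 - m%:Z)%R; last by lia.
  rewrite translationD translation_shift.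
  by apply/set_mem/(group_closedM BG); apply/mem_set.
have [le0|ge0] : (n <= 0 \/ 0 <= n)%R by lia.
  by rewrite (_ : n = - (absz n)%:Z)%R //; lia.
rewrite (_ : n = - (- (absz n)%:Z))%R; last by lia.
by rewrite translationN; apply/set_mem/(group_closedV BG)/mem_set.
Qed.

Lemma houghton2_setP (g : sym int) : houghton2_set g <->
  exists n : int, finite_set [set k : int | g k <> (k + n)%R]%classic.
Proof.
split=> [[s fs [c /generated_shift[n cn] <-]]|[n fn]].
  exists n; have cinj := @sym_inj int c.
  have : finite_set (c @^-1` [set k | s k <> k])%classic.
    by apply: finite_preimage fs => x y _ _; apply: cinj.
  by apply: sub_finite_set => k /=; rewrite cn.
exists (g * translation (- n)%R).
  rewrite /FSym /=; have := finite_image (translation n) fn.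
  apply: sub_finite_set => k /= gk; exists (k - n)%R; last by rewrite subrK.
  by rewrite subrK.
exists (translation n); last by rewrite translationN mulgVK.
by move=> A [AG As]; apply: translation_generate => //; apply: As.
Qed.

Lemma houghton2_eventually (g : houghton2) : exists (n : int) (M : nat),
  forall k : int, (M <= absz k)%N -> g k = (k + n)%R.
Proof.
have /set_mem/houghton2_setP[n] := houghton2_valP g.
move=> /finite_seqP[s fs]; exists n, (\max_(k <- s) absz k).+1 => k kM.
apply: contrapT => gk; have : [set k : int | g k <> (k + n)%R]%classic k by [].
rewrite fs /= => ks; move: kM; rewrite ltnNge.
by rewrite (@leq_bigmax_seq _ s xpredT absz).
Qed.

(** The value [1] outside [houghton2_set] makes this total, so that elements can be written down as
    plain permutations. *)
Definition houghton2_of (g : sym int) : houghton2 := insubd (1 : houghton2) g.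

Lemma houghton2_ofE g : houghton2_set g -> houghton2_of g = g :> sym int.
Proof. by move=> hg; rewrite /houghton2_of insubdK //; apply/mem_set. Qed.

Lemma houghton2_valM (g h : houghton2) :
  (g * h : houghton2) = (g : sym int) * (h : sym int) :> sym int.
Proof. exact: (valM g h). Qed.

Lemma houghton2_val_inj : injective houghton2_val.
Proof. exact: val_inj. Qed.

Lemma houghton2_of_val (g : houghton2) : houghton2_of g = g.
Proof. by apply: houghton2_val_inj; apply/houghton2_ofE/set_mem/houghton2_valP. Qed.

Lemma houghton2_ofM g h : houghton2_set g -> houghton2_set h ->
  houghton2_of (g * h) = houghton2_of g * houghton2_of h.
Proof.
move=> hg hh; apply: houghton2_val_inj; rewrite houghton2_valM !houghton2_ofE //.
by apply/set_mem/(group_closedM houghton2_group); apply/mem_set.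
Qed.

Lemma houghton2_translation n : houghton2_set (translation n).
Proof.
apply/houghton2_setP; exists n.
by apply: sub_finite_set (finite_set0 _) => k /=; apply.
Qed.

Lemma houghton2_FSym (g : sym int) : FSym g -> houghton2_set g.
Proof.
move=> fg; apply/houghton2_setP; exists 0%R.
by apply: sub_finite_set fg => k /=; rewrite addr0.
Qed.

Definition trans n := houghton2_of (translation n).
Definition transp i j := houghton2_of (swap i j : sym int).

Lemma transE n k : trans n k = (k + n)%R.
Proof. by rewrite houghton2_ofE //; apply: houghton2_translation. Qed.

Lemma transpE i j : transp i j = swap i j :> sym int.
Proof. by rewrite houghton2_ofE //; apply/houghton2_FSym/FSym_swap. Qed.

Lemma houghton2_eqP (g h : houghton2) : (forall k, g k = h k) -> g = h.
Proof. by move=> gh; apply/houghton2_val_inj/sym_eqP. Qed.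

Lemma transD m n : trans (m + n)%R = trans m * trans n.
Proof.
by apply: houghton2_eqP => k; rewrite houghton2_valM symME !transE; lia.
Qed.

Lemma trans0 : trans 0%R = 1.
Proof. by apply: houghton2_eqP => k; rewrite transE addr0. Qed.

Lemma transN n : trans (- n)%R = (trans n)^-1.
Proof.
by apply: (mulgI (trans n)); rewrite mulgV -transD subrr trans0.
Qed.

Lemma transp_conj (g : houghton2) i j :
  g * transp i j * g^-1 = transp (g i) (g j).
Proof.
apply: (mulIg g); rewrite mulgVK; apply: houghton2_val_inj.
rewrite !houghton2_valM !transpE -(swap_conj (g : sym int)).
by rewrite mulgVK.
Qed.

Lemma transpV i j : (transp i j)^-1 = transp i j.
Proof.
apply: (mulgI (transp i j)); rewrite mulgV; apply: houghton2_eqP => k.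
by rewrite houghton2_valM symME !transpE -{1}swapV symKV.
Qed.

Lemma transp_mulK i j : transp i j * transp i j = 1.
Proof. by rewrite -{1}(transpV i j) mulVg. Qed.

Lemma transpC i j : transp i j = transp j i.
Proof. by rewrite /transp swapC. Qed.

(** Conjugating [(e i, e j)] by [(e j, e j.+1)] gives [(e i, e j.+1)]. The enumeration [e] allows
    for half-lines in both directions. *)
Lemma adjacent_transp (A : houghton2 -> Prop) (e : nat -> int) : injective e ->
    (forall g h, A g -> A h -> A (g * h)) ->
    (forall i, A (transp (e i) (e i.+1))) ->
  forall i j, i <> j -> A (transp (e i) (e j)).
Proof.
move=> eI AM Aadj.
have up i n : A (transp (e i) (e (i + n.+1)%N)).
  elim: n => [|n IHn]; first by rewrite addn1.
  set j := (i + n.+1)%N in IHn *; rewrite addnS -/j.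
  have := transp_conj (transp (e j) (e j.+1)) (e i) (e j).
  have ij : (i == j) = false by rewrite /j; lia.
  have ij1 : (i == j.+1) = false by rewrite /j; lia.
  rewrite transpV !transpE !swapE eqxx !(inj_eq eI) ij ij1.
  by move=> <-; apply: (AM); [apply: (AM)|].
move=> i j ij; have [lt|gt] : (i < j \/ j < i)%N by lia.
  by rewrite (_ : j = i + (j - i).-1.+1)%N //; lia.
by rewrite transpC (_ : i = j + (i - j).-1.+1)%N //; lia.
Qed.

Lemma houghton2_generate (A : set houghton2) : group_closed (mem A) ->
  A (trans (-1)%R) -> A (transp 0%R 1%R) -> forall g, A g.
Proof.
move=> AG At As.
have A1 : A 1 by apply/set_mem/AG.1.
have AM g h : A g -> A h -> A (g * h).
  by move=> b1 b2; apply/set_mem/(group_closedM AG); apply/mem_set.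
have AV g : A g -> A g^-1.
  by move=> b1; apply/set_mem/(group_closedV AG)/mem_set.
pose B : set (sym int) := [set g | houghton2_set g /\ A (houghton2_of g)]%classic.
have BG : group_closed (mem B).
  split=> [|g h /set_mem[hg Ag] /set_mem[hh Ah]]; apply/mem_set; split.
  - exact/set_mem/houghton2_group.1.
  - by rewrite (houghton2_of_val 1).
  - by apply/set_mem/houghton2_group.2; apply/mem_set.
  have hh' : houghton2_set h^-1.
    by apply/set_mem/(group_closedV houghton2_group)/mem_set.
  rewrite houghton2_ofM //; apply: (AM) => //.
  rewrite (_ : houghton2_of h^-1 = (houghton2_of h)^-1); first exact: AV.
  apply: (mulgI (houghton2_of h)); rewrite mulgV -houghton2_ofM // mulgV.
  exact: (houghton2_of_val 1).
have Btr n : B (translation n).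
  apply: translation_generate => //; split.
    by rewrite -translation_shift; apply: houghton2_translation.
  by rewrite -translation_shift.
have Atr n : A (trans n) by case: (Btr n).
have Aadj i : A (transp i (i + 1)%R).
  have := transp_conj (trans i) 0%R 1%R; rewrite !transE add0r addrC => <-.
  by apply: (AM); [apply: (AM) | apply: AV].
have Bsw i j : B (swap i j).
  split; first exact/houghton2_FSym/FSym_swap.
  change (A (transp i j)); have [<-|ij] := eqVneq i j.
    rewrite (_ : transp i i = 1) //; apply: houghton2_eqP => k.
    by rewrite transpE swapE; case: eqVneq => [->|].
  (* Numbering the integers upwards from the smaller of [i] and [j] covers negative entries too. *)
  pose e (n : nat) := (Num.min i j + n%:Z)%R.
  have eI : injective e by move=> m n; rewrite /e; lia.
    have eS n : (e n.+1 = e n + 1)%R by rewrite /e; lia.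
  have := @adjacent_transp A e eI AM _ (absz (i - Num.min i j)%R)
    (absz (j - Num.min i j)%R).
  rewrite /e (_ : Num.min i j + absz (i - _) = i)%R; last by lia.
  rewrite (_ : Num.min i j + absz (j - _) = j)%R; last by lia.
  apply; last by move/eqP: ij; lia.
  by move=> n; rewrite -/(e n) -/(e n.+1) eS.
move=> g; have /set_mem[s fs [c /generated_shift[n cn] e]] := houghton2_valP g.
have : B g.
  rewrite -e; apply/set_mem/(group_closedM BG); apply/mem_set.
    exact: swap_generate.
  by rewrite (_ : c = translation n) //; apply: sym_eqP => k; rewrite cn.
by case=> _; rewrite houghton2_of_val.
Qed.

Lemma houghton2_finitely_generated : finitely_generated houghton2.
Proof.
exists [set trans (-1)%R; transp 0%R 1%R]%classic; first exact: finite_set2.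
apply/seteqP; split=> // g _ A [AG Asub].
by apply: houghton2_generate => //; apply: Asub; [left | right].
Qed.

Lemma finite_houghton2_supported (s : seq int) :
  finite_set [set g : houghton2 | forall k, k \notin s -> g k = k]%classic.
Proof.
by apply: finite_preimage (finite_supported s) => g h _ _; apply: val_inj.
Qed.

End Houghton2.

(** * Replacing integers by blocks *)

Section Inflation.
Variable b : nat.
Local Open Scope group_scope.
Let B : int := b.+1.

(** [g] permutes the blocks of [B] consecutive integers, and the position within a block is kept. *)
Definition inflate_fun (g : int -> int) (k : int) : int :=
  (g (k %/ B)%Z * B + (k %% B)%Z)%R.

Lemma inflate_divmod g k :
  (inflate_fun g k %/ B)%Z = g (k %/ B)%Z /\
  (inflate_fun g k %% B)%Z = (k %% B)%Z.
Proof.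
rewrite /inflate_fun divzMDl // modzMDl modz_mod.
rewrite (@divz_small (k %% B)%Z) ?addr0 //.
by rewrite modz_ge0 //= ltz_pmod.
Qed.

Lemma inflate_funK g h : cancel g h -> cancel (inflate_fun g) (inflate_fun h).
Proof.
move=> gK k; rewrite {1}/inflate_fun.
by have [-> ->] := inflate_divmod g k; rewrite gK -divz_eq.
Qed.

Definition inflate (g : sym int) : sym int :=
  Sym (inflate_funK (@symK _ g)) (inflate_funK (@symVK _ g)).

Lemma inflateE g k : inflate g k = (g (k %/ B)%Z * B + (k %% B)%Z)%R.
Proof. by []. Qed.

Lemma inflateM g h : inflate (g * h) = inflate g * inflate h.
Proof.
apply: sym_eqP => k; rewrite symME [RHS]inflateE.
by have [-> ->] := inflate_divmod h k.
Qed.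

Lemma inflate_houghton2 g : houghton2_set g -> houghton2_set (inflate g).
Proof.
move=> /houghton2_setP[n fn]; apply/houghton2_setP; exists (n * B)%R.
have fr : finite_set (Posz @` `I_b.+1)%classic by apply/finite_image/finite_II.
have := finite_image2 (fun q r : int => (q * B + r)%R) fn fr.
apply: sub_finite_set => k /=; rewrite /inflate_fun => gk.
exists (k %/ B)%Z.
  by apply: contra_not gk => ->; rewrite mulrDl addrAC -divz_eq.
exists (k %% B)%Z; last by rewrite -divz_eq.
exists (absz (k %% B)%Z); last by rewrite gez0_abs // modz_ge0.
by have := @ltz_pmod k B isT; have := @modz_ge0 k B isT; rewrite /B /=; lia.
Qed.

Definition inflate_hom (g : houghton2) := houghton2_of (inflate g).

Lemma inflate_homE g : inflate_hom g = inflate g :> sym int.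
Proof.
by rewrite houghton2_ofE //; apply/inflate_houghton2/set_mem/houghton2_valP.
Qed.

Lemma inflate_homM g h : inflate_hom (g * h) = inflate_hom g * inflate_hom h.
Proof.
apply: houghton2_val_inj.
by rewrite houghton2_valM !inflate_homE houghton2_valM inflateM.
Qed.

Lemma inflate_hom_inj : injective inflate_hom.
Proof.
move=> g h gh; apply: houghton2_eqP => k.
have : inflate g (k * B)%R = inflate h (k * B)%R by rewrite -!inflate_homE gh.
rewrite !inflateE mulzK // => /addIr/mulIf; exact.
Qed.

Lemma trans_exp n : trans (- n%:Z)%R = trans (-1)%R ^+ n.
Proof.
elim: n => [|n IHn]; first by rewrite oppr0 trans0 expg0.
by rewrite expgS -IHn -transD; congr trans; lia.
Qed.

Lemma inflate_trans : inflate_hom (trans (-1)%R) = trans (-1)%R ^+ b.+1.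
Proof.
rewrite -trans_exp; apply: houghton2_eqP => k.
rewrite inflate_homE inflateE !transE mulrDl addrAC -divz_eq mulN1r //.
Qed.

Section Rotation.
Variable m : nat.

Definition rotation_fun (j k : int) : int :=
  if (0 <= k < m%:Z)%R then ((k + j) %% m%:Z)%Z else k.

Lemma rotation_funD i j k :
  rotation_fun i (rotation_fun j k) = rotation_fun (j + i) k.
Proof.
rewrite {2 3}/rotation_fun; case: ifP => [km|km]; last first.
  by rewrite /rotation_fun km.
have m0 : (m%:Z != 0)%R by lia.
rewrite /rotation_fun modz_ge0 //= ltz_pmod; last by lia.
by rewrite modzDml addrA.
Qed.

Lemma rotation_fun0 k : rotation_fun 0 k = k.
Proof. by rewrite /rotation_fun; case: ifP => // km; rewrite addr0 modz_small. Qed.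

Lemma rotation_funK j : cancel (rotation_fun j) (rotation_fun (- j)).
Proof. by move=> k; rewrite rotation_funD subrr rotation_fun0. Qed.

Lemma rotation_funVK j : cancel (rotation_fun (- j)) (rotation_fun j).
Proof. by move=> k; rewrite rotation_funD addNr rotation_fun0. Qed.

Definition rotation j : sym int := Sym (rotation_funK j) (rotation_funVK j).

Lemma rotation_FSym j : FSym (rotation j).
Proof.
have fr : finite_set (Posz @` `I_m)%classic by apply/finite_image/finite_II.
apply: sub_finite_set fr => k /=; rewrite /rotation_fun.
case: ifP => // km _; exists (absz k); rewrite /=; lia.
Qed.

Lemma rotation_exp n :
  houghton2_of (rotation (Posz n)) = houghton2_of (rotation 1) ^+ n.
Proof.
have hr j : houghton2_set (rotation j) by apply/houghton2_FSym/rotation_FSym.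
elim: n => [|n IHn].
  rewrite expg0; apply: houghton2_eqP => k.
  by rewrite houghton2_ofE //= rotation_fun0.
rewrite expgS -IHn -houghton2_ofM //; congr houghton2_of; apply: sym_eqP => k.
by rewrite symME /= rotation_funD; congr rotation_fun; lia.
Qed.

End Rotation.

(* Exchanging two adjacent blocks of length [b + 1] is the [b + 1]-st power of
   a cycle of length [2 (b + 1)]. *)
Lemma inflate_transp : exists w, inflate_hom (transp 0%R 1%R) = w ^+ b.+1.
Proof.
exists (houghton2_of (rotation (b.+1 + b.+1) 1)); rewrite -rotation_exp.
apply: houghton2_eqP => k.
rewrite inflate_homE houghton2_ofE; last exact/houghton2_FSym/rotation_FSym.
rewrite inflateE transpE swapE /= /rotation_fun -/B.
have r0 := @modz_ge0 k B isT; have r1 := @ltz_pmod k B isT.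
have ek := divz_eq k B.
set q := (k %/ B)%Z in ek *; set r := (k %% B)%Z in ek r0 r1 *.
have B2 : ((b.+1 + b.+1)%N%:Z = B + B)%R by rewrite /B; lia.
rewrite B2; case: (eqVneq q 0%R) ek => [-> ek|q0].
  rewrite modz_small; first by case: ifP; lia.
  by lia.
case: (eqVneq q 1%R) => [-> ek|q1 ek].
  rewrite ifT; last by lia.
  by rewrite (_ : k + B = 1 * (B + B) + r)%R ?modzMDl ?modz_small //; lia.
rewrite ifF //; apply/negP => /andP[k0 kB].
have : (q < 0 \/ 2 <= q)%R by lia.
by case=> h; nia.
Qed.

End Inflation.

(** * Actions on a locally finite tree *)

Lemma finite_set_bounded (X : Type) (A : set X) (f : X -> nat) :
  finite_set A -> exists r, forall x, A x -> f x <= r.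
Proof.
move=> /(finite_image f)/finite_seqP[s fs]; exists (\max_(k <- s) k) => x Ax.
have : [set f y | y in A]%classic (f x) by exists x.
by rewrite fs /= => xs; apply: (@leq_bigmax_seq _ s xpredT id).
Qed.

Lemma pigeonhole_nat (U : finType) (f : nat -> U) :
  exists p q, p <> q /\ f p = f q.
Proof.
apply: contrapT => bad; apply: infinite_nat.
apply: (sub_finite_set (B := f @^-1` setT)) => //.
apply: finite_preimage => [p q _ _ fpq|]; last exact: finite_finset.
by apply: contrapT => pq; apply: bad; exists p, q.
Qed.

Section Action.
Variables (T : tree) (a : houghton2 -> T -> T).
Local Open Scope group_scope.
Hypothesis T_lf : locally_finite T.
Hypothesis a1 : forall x, a 1 x = x.
Hypothesis aM : forall g h x, a (g * h) x = a g (a h x).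
Hypothesis a_iso : forall g, isometry (a g).
Hypothesis a_even : forall g x, ~~ odd (dist x (a g x)).
Implicit Types (x y z : T).

(** The elements supported in [0, ..., n.+1] form a finite group containing these transpositions,
    and its orbits are bounded. *)
Lemma window_fixed (n : nat) : exists z, forall j : nat, (j <= n)%N ->
  a (transp j (j%:Z + 1)%R) z = z.
Proof.
have [x] := tree_nonempty T.
pose s : seq int := [seq Posz i | i <- iota 0 n.+2].
pose K : set houghton2 := [set g | forall k, k \notin s -> g k = k]%classic.
have [r Kr] := finite_set_bounded (fun g => dist x (a g x))
  (finite_houghton2_supported s : finite_set K).
have [||z zK] := @bounded_orbit_fixed T _ a a1 aM a_iso a_even K x r _ _ Kr.
- by [].
- move=> g h gK hK k ks; rewrite houghton2_valM symME hK //.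
  have e : g^-1 (g k) = k.
    by rewrite -[LHS]symME -houghton2_valM mulVg.
  by rewrite -{1}(gK _ ks).
exists z => j jn; apply: zK => k ks; rewrite transpE swapE.
have mem (i : nat) : (i < n.+2)%N -> k != i.
  by move=> lt; apply: contraNneq ks => ->; rewrite map_f // mem_iota.
have := mem j; have := mem j.+1; rewrite PoszS.
by move=> /(_ jn)/negbTE -> /(_ (leqW jn))/negbTE ->.
Qed.

(** [ray_in_convex] is applied to the fixed subtree of [(0 1)]: translation by [-i] carries [x] into
    it exactly when [(i, i + 1)] fixes [x]. *)
Lemma ray_fixed : exists x,
  (forall j : nat, a (transp j (j%:Z + 1)%R) x = x) \/
  (forall j : nat, a (transp (- j%:Z)%R (- j%:Z + 1)%R) x = x).
Proof.
have tr i x : a (transp 0%R 1%R) (a (trans (- i)%R) x) = a (trans (- i)%R) x ->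
    a (transp i (i + 1)%R) x = x.
  move=> fx; have := transp_conj (trans i) 0%R 1%R.
  rewrite !transE add0r addrC => <-.
  by rewrite !aM -transN fx -aM -transD subrr trans0.
have rt i x : a (transp i (i + 1)%R) x = x ->
    a (transp 0%R 1%R) (a (trans (- i)%R) x) = a (trans (- i)%R) x.
  move=> fx; rewrite -[in RHS]fx -!aM; congr a.
  have := transp_conj (trans i) 0%R 1%R; rewrite !transE add0r addrC => <-.
  by rewrite !mulgA -transD addNr trans0 mul1g transN.
have [||||||x xY] := @ray_in_convex T (fun i => a (trans (- i)%R)) _ _ _ _
  [set x | a (transp 0%R 1%R) x = x]%classic.
- by move=> x; rewrite oppr0 trans0 a1.
- by move=> i j x; rewrite opprD transD aM.
- by move=> i; apply: a_iso.
- by move=> i x; apply: a_even.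
- exact: convex_fixpoints.
- by move=> n; have [z zn] := window_fixed n; exists z => j /zn/rt.
by exists x; case: xY => xY; [left | right] => j; apply/tr/xY.
Qed.

Lemma ray_transpositions_equal (e : nat -> int) x : injective e ->
    (forall i, a (transp (e i) (e i.+1)) x = x) ->
  forall i j k l y, i <> j -> k <> l ->
    a (transp (e i) (e j)) y = a (transp (e k) (e l)) y.
Proof.
move=> eI adj; pose t i j := transp (e i) (e j).
have tx i j : i <> j -> a (t i j) x = x.
  apply: (@adjacent_transp (fun g => a g x = x) e eI) => // g h gx hx.
  by rewrite aM hx.
suff base y : exists f : T -> T, forall i j, i <> j -> a (t i j) y = f y.
  by move=> i j k l y ij kl; have [f fE] := base y; rewrite (fE i j) ?(fE k l).
(* This finite ball contains [y] and is stable under all the transpositions, as they fix its centre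
   [x]. *)
pose ball := [set z | (dist x z <= dist x y)%N]%classic.
have ballE i j z : i <> j -> ball z -> ball (a (t i j) z).
  by move=> ij bz; rewrite /ball /= -(tx i j ij) a_iso (tx i j ij).
have [s bs] : exists s : seq T, ball = [set` s]%classic.
  by apply/finite_seqP; apply: finite_ball.
have sP z : ball z -> z \in s by rewrite bs.
pose f n : {ffun 'I_(size s) -> 'I_(size s).+1} := [ffun i =>
  insubd (@ord_max (size s)) (index (a (t 0 n.+1) (tnth (in_tuple s) i)) s)].
have [p [q [pq fpq]]] := pigeonhole_nat f.
have {f fpq} eqpq z : ball z -> a (t 0 p.+1) z = a (t 0 q.+1) z.
  move=> bz; have zs := sP _ bz.
  have iz : (index z s < size s)%N by rewrite index_mem.
  have := congr1 val (proj2 (ffunP _ _) fpq (Ordinal iz)).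
  rewrite !ffunE (tnth_nth z) /= nth_index // !val_insubd !ltnS !index_size => e1.
  rewrite -(nth_index z (sP _ (ballE 0 p.+1 _ _ bz))) // e1 nth_index //.
  by apply: sP; apply: ballE.
have tt i j z : a (t i j) (a (t i j) z) = z by rewrite -aM transp_mulK a1.
have conj i j k z : i <> j -> i <> k -> j <> k ->
    a (t j k) (a (t i j) (a (t j k) z)) = a (t i k) z.
  move=> ij ik jk; rewrite -!aM; have := transp_conj (t j k) (e i) (e j).
  rewrite transpV !transpE !swapE eqxx !(inj_eq eI).
  by rewrite (introF eqP ij) (introF eqP ik) => ->.
pose u := a (t 0 p.+1).
(* Conjugation by [t q.+1 c.+1] turns [t 0 q.+1] into [t 0 c.+1] but commutes with [t 0 p.+1]; these
   two agree on the ball, so [t 0 c.+1] also acts as [u]. *)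
have uE c z : ball z -> a (t 0 c.+1) z = u z.
  move=> bz; have [->//|cp] := eqVneq c p.
  have [->|cq] := eqVneq c q; first by rewrite /u eqpq.
  have qc : q.+1 <> c.+1 by move/eqP: cq; lia.
  have pc : p.+1 <> c.+1 by move/eqP: cp; lia.
  have bz' : ball (a (t q.+1 c.+1) z) by apply: ballE.
  rewrite -(conj 0 q.+1 c.+1) // -eqpq // /u -!aM.
  have := transp_conj (t q.+1 c.+1) (e 0) (e p.+1).
  rewrite /t !transpE !swapE !(inj_eq eI) (introF eqP pc).
  have -> : (p.+1 == q.+1) = false by apply/eqP; lia.
  by rewrite transpV => ->.
have uball z : ball z -> ball (u z) by apply: ballE.
exists u => i j ij; have by_ : ball y by rewrite /ball /=.
case: i j ij => [|i] [|j] ij //; first exact: uE.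
  by rewrite /t transpC uE.
(* A transposition avoiding index 0 is a product of three transpositions involving it, so it acts as
   the cube of the involution [u]. *)
rewrite -(conj i.+1 0 j.+1) //.
have b1 := uball _ by_; have b2 := uball _ b1.
by rewrite [t i.+1 0]transpC !uE // /u tt.
Qed.

Lemma three_cycles_trivial (m : nat) y : (1 < m)%N ->
  a (transp 0%R 1%R * transp 0%R m) y = y.
Proof.
move=> m1; rewrite aM; suff -> : a (transp 0%R m) y = a (transp 0%R 1%R) y.
  by rewrite -aM transp_mulK a1.
have [x [xf|xf]] := ray_fixed.
  have eI : injective Posz by move=> i j [].
  have adj (i : nat) : a (transp i i.+1) x = x by rewrite PoszS.
  have eqt := ray_transpositions_equal eI adj (i := 0%N) (k := 0%N) (l := 1%N).
  by apply: eqt; lia.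
(* The half-line of integers at most 1, numbered downwards. *)
pose e (n : nat) : int := (1 - n%:Z)%R.
have eI : injective e by move=> i j; rewrite /e; lia.
have adj i : a (transp (e i) (e i.+1)) x = x.
  have -> : e i = (- i%:Z + 1)%R by rewrite /e; lia.
  have -> : e i.+1 = (- i%:Z)%R by rewrite /e; lia.
  by rewrite transpC xf.
(* The pairs [(-m, 0)] and [(-m, 1 - m)] lie in this half-line; translation by [m] takes them to
   [(0, m)] and [(0, 1)]. *)
have eqt := ray_transpositions_equal eI adj
  (i := m.+1) (j := 1) (k := m.+1) (l := m).
have c1 := transp_conj (trans m) (e m.+1) (e 1%N).
have c2 := transp_conj (trans m) (e m.+1) (e m).
rewrite !transE in c1 c2.
rewrite (_ : e m.+1 + m = 0)%R in c1 c2; last by rewrite /e; lia.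
rewrite (_ : e 1%N + m = m)%R in c1; last by rewrite /e; lia.
rewrite (_ : e m + m = 1)%R in c2; last by rewrite /e; lia.
by rewrite -c1 -c2 !aM; congr a; apply: eqt; lia.
Qed.

End Action.

(** * Actions on products of locally finite trees are not proper *)

Section NoProperAction.
Variables (n : nat) (T : 'I_n -> tree).
Variable rho : {multiplicative houghton2 -> prod_aut T}.
Local Open Scope group_scope.

Let b := (n`! * 2).-1%N.

Lemma block_length : b.+1 = (n`! * 2)%N.
Proof. by rewrite prednK // muln_gt0 fact_gt0. Qed.

Lemma rhoX g m : rho (g ^+ m) = rho g ^+ m.
Proof.
elim: m => [|m IHm]; last by rewrite !expgS gmulfM IHm.
by rewrite !expg0; apply: (mulgI (rho 1)); rewrite -gmulfM !mulg1.
Qed.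

Let psi g := rho (inflate_hom b g).

Lemma psiM g h : psi (g * h) = psi g * psi h.
Proof. by rewrite /psi inflate_homM gmulfM. Qed.

Lemma psi1 : psi 1 = 1.
Proof. by apply: (mulgI (psi 1)); rewrite -psiM !mulg1. Qed.

Lemma psiV g : psi g^-1 = (psi g)^-1.
Proof. by apply: (mulgI (psi g)); rewrite -psiM !mulgV psi1. Qed.

Lemma psi_even g : even_aut (psi g).
Proof.
have [E1 EV] := even_aut_group T.
have power w : even_aut (rho (w ^+ b.+1)).
  rewrite block_length expgnA !rhoX.
  by apply: even_aut_sqr; apply: factorwise_exp.
apply: (@houghton2_generate [set g | even_aut (psi g)]%classic).
- split=> [|g1 g2 /set_mem eg1 /set_mem eg2]; apply/mem_set => /=.
    by rewrite psi1; apply/set_mem.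
  by rewrite psiM psiV; apply/set_mem/EV; apply/mem_set.
- by rewrite /= /psi inflate_trans.
- by rewrite /= /psi; have [w ->] := inflate_transp b.
Qed.

Hypothesis T_lf : forall i, locally_finite (T i).

Lemma three_cycle_fixes m (v : prod_vertex T) :
  psi (transp 0%R 1%R * transp 0%R m.+2) v = v.
Proof.
apply: vertex_eq => i.
(* The induced action on the [i]-th tree; by [fact] the coordinates filled in from [v] do not
   matter. *)
pose a g (x : T i) := psi g (dfwith v x) i.
have ext (u : prod_vertex T) : dfwith v (u i) i = u i by rewrite dfwith_in.
have fact g (u : prod_vertex T) : a g (u i) = psi g u i.
  by apply: factorwise_coordinate (ext u); apply: (psi_even g).1.
rewrite -fact; apply: (@three_cycles_trivial (T i) a) => //.
- by move=> x; rewrite /a psi1 [LHS]dfwith_in.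
- by move=> g h x; rewrite {1}/a psiM prod_autM -fact.
- by move=> g x y; rewrite factorwise_dist ?dfwith_in //; apply: (psi_even g).1.
- by move=> g x; have := (psi_even g).2 (dfwith v x) i; rewrite dfwith_in.
Qed.

Lemma not_proper : ~ proper_action rho.
Proof.
move=> proper.
have T_point i : exists x : T i, True.
  by have [x] := tree_nonempty (T i); exists x.
pose v : prod_vertex T := fun i => projT1 (cid (T_point i)).
pose c (m : nat) := inflate_hom b (transp 0%R 1%R * transp 0%R m.+2).
apply: infinite_nat; have := proper v.
move=> /(@finite_preimage _ _ _ c) fin.
apply: sub_finite_set (fin _) => [m _ /=|m m' _ _ /inflate_hom_inj e].
  exact: three_cycle_fixes.
(* The products are distinguished by the image [m.+2] of 0. *)
have := congr1 (fun g : houghton2 => g 0%R) e.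
by rewrite !houghton2_valM !symME !transpE !swapE /=; lia.
Qed.

End NoProperAction.

(** * The two Bass-Serre trees *)

Section ParentTree.
Variables (V : eqType) (parent : V -> V) (height : V -> int).
Hypothesis height_parent : forall x, height (parent x) = (height x + 1)%R.
Hypothesis common_ancestor :
  forall x y, exists m n, iter m parent x = iter n parent y.
Hypothesis V_inhabited : inhabited V.

Definition parent_adj x y := (parent x == y) || (parent y == x).

Lemma parent_adj_sym : symmetric parent_adj.
Proof. by move=> x y; rewrite /parent_adj orbC. Qed.

Lemma parent_adj_irr : irreflexive parent_adj.
Proof.
move=> x; rewrite /parent_adj orbb; apply/eqP => e.
by have := height_parent x; rewrite e; lia.
Qed.

Lemma parent_connected x y : exists2 p, path parent_adj x p & last x p = y.
Proof.
have up m z : exists2 p, path parent_adj z p & last z p = iter m parent z.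
  exists (traject parent (parent z) m); last by rewrite last_traject.
  elim: m z => //= m IHm z; rewrite IHm andbT /parent_adj eqxx //.
have [m [n e]] := common_ancestor x y.
have [p pp pl] := up m x; have [q qp ql] := up n y.
exists (p ++ rev (belast y q)).
  rewrite cat_path pp pl e -ql rev_path.
  by under eq_path => u v do rewrite parent_adj_sym.
rewrite last_cat pl e -ql; case: (q) => //= u r.
by rewrite rev_cons last_rcons.
Qed.

(* A vertex of minimal height on a cycle would have both of its cyclic
   neighbours equal to its parent. *)
Lemma parent_acyclic p : ucycle parent_adj p -> (size p <= 2)%N.
Proof.
case: p => // x0 p0 /andP[cyc uniq_p].
have [x xp min] : exists2 x, x \in x0 :: p0 &
    forall y, y \in x0 :: p0 -> (height x <= height y)%R.
  elim: p0 x0 {cyc uniq_p} => [|y p0 IHp] x0.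
    by exists x0; rewrite ?inE // => y; rewrite inE => /eqP ->.
  have [x xp min] := IHp y.
  have [le|lt] : (height x0 <= height x \/ height x < height x0)%R by lia.
    exists x0; rewrite ?inE ?eqxx // => z.
    rewrite inE => /orP[/eqP -> //|/min]; lia.
  exists x; first by rewrite inE xp orbT.
  by move=> z; rewrite inE => /orP[/eqP -> |/min]; lia.
have [k q rotq] := rot_to xp.
rewrite -(size_rot k) rotq.
have cyc' : cycle parent_adj (x :: q) by rewrite -rotq rot_cycle.
have uniq' : uniq (x :: q) by rewrite -rotq rot_uniq.
have {xp}min y : y \in q -> parent_adj x y -> parent x = y.
  move=> yq /orP[/eqP //|/eqP yx].
  have : (height x <= height y)%R.
    by apply: min; rewrite -(mem_rot k) rotq inE yq orbT.
  by have := height_parent y; rewrite yx; lia.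
case: q {rotq} cyc' uniq' min => [|y q] //= /andP[xy].
rewrite rcons_path => /andP[_ lx] /andP[_ /andP[yq _]] min.
have ey : parent x = y by apply: min; rewrite ?inE ?eqxx.
have : parent x = last y q.
  by apply: min; [apply: mem_last | rewrite parent_adj_sym].
rewrite ey; case: q yq {lx min} => //= z q yq e.
by move: yq; rewrite e mem_last.
Qed.

Definition parent_tree : tree :=
  Tree parent_adj_sym parent_adj_irr V_inhabited parent_connected parent_acyclic.

End ParentTree.

(** * Automorphisms of a product from automorphisms of its factors *)

Section CoordinatewiseAutomorphisms.
Local Open Scope classical_set_scope.
Local Open Scope group_scope.

Lemma simplex_image (S : tree) (f : S -> S) (A : set S) :
    (forall x y, adj x y -> adj (f x) (f y)) -> simplex A -> simplex (f @` A).
Proof.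
move=> fadj [[x ->]|[x [y [xy ->]]]].
  by left; exists (f x); rewrite image_set1.
right; exists (f x), (f y); split; first exact: fadj.
by rewrite image_setU !image_set1.
Qed.

Lemma image_symV (X : Type) (f : sym X) (A : set X) : f^-1 @` (f @` A) = A.
Proof.
rewrite image_comp (_ : f^-1 \o f = id) ?image_id //.
by apply/funext => x; apply: symK.
Qed.

Lemma adj_cellular (S : tree) (f : sym S) :
    (forall x y, adj x y -> adj (f x) (f y)) ->
    (forall x y, adj x y -> adj (f^-1 x) (f^-1 y)) ->
  f \in cellular (@simplex S).
Proof.
move=> fadj fVadj; apply/mem_set => A; split; last exact: simplex_image.
by move=> /(simplex_image fVadj); rewrite image_symV.
Qed.

Variables (n : nat) (T : 'I_n -> tree).

Lemma prod_symK (a : forall i, sym (T i)) :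
  cancel (fun (v : prod_vertex T) i => a i (v i)) (fun v i => (a i)^-1 (v i)).
Proof. by move=> v; apply: functional_extensionality_dep => i; apply: symK. Qed.

Lemma prod_symVK (a : forall i, sym (T i)) :
  cancel (fun (v : prod_vertex T) i => (a i)^-1 (v i)) (fun v i => a i (v i)).
Proof. by move=> v; apply: functional_extensionality_dep => i; apply: symVK. Qed.

Definition prod_sym a : sym (prod_vertex T) := Sym (@prod_symK a) (@prod_symVK a).

Lemma prod_sym_cube (a : forall i, tree_aut (T i)) (C : set (prod_vertex T)) :
  cube C -> cube (prod_sym a @` C).
Proof.
move=> [F Fs ->]; exists (fun i => a i @` F i).
  by move=> i; have /set_mem cell := cell_aut_valP (a i); apply/(cell (F i)).2.
apply/seteqP; split=> [_ [v vF <-] i|w wF]; first by exists (v i).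
exists (fun i => (a i : sym (T i))^-1 (w i)) => [i|].
  by have [x xF <-] := wF i; rewrite symVE symK.
by apply: functional_extensionality_dep => i; apply: symVK.
Qed.

Lemma prod_sym_cellular (a : forall i, tree_aut (T i)) :
  prod_sym a \in cellular (@cube n T).
Proof.
apply/mem_set => C; split; last exact: prod_sym_cube.
move=> /(@prod_sym_cube (fun i => (a i)^-1)).
rewrite (_ : (prod_sym (fun i => (a i)^-1) : _ -> _) = (prod_sym a)^-1) //.
by rewrite image_symV.
Qed.

Definition prod_aut_of a : prod_aut T := CellAut (prod_sym_cellular a).

End CoordinatewiseAutomorphisms.

(** * The tree of eventually straight sequences at one end of the integers *)

Section RayTree.
Variable eps : bool.
Let sg : int := if eps then 1%R else (-1)%R.

Definition eventually_straight (f : nat -> int) : Prop :=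
  exists (c : int) (M : nat), forall i : nat,
    (M <= i)%N -> f i = (sg * (c + i%:Z))%R.

(* The Bass-Serre tree of [houghton2], seen as an ascending HNN extension of
   the finitary permutations of a half-line [R], has as vertices the cosets of
   the pointwise stabiliser of the complementary half-line, that is, certain
   injections of that half-line into the integers. Injectivity plays no role,
   so it is not required here. *)
Record ray_vertex := RayVertex {
  ray_fun :> nat -> int;
  ray_funP : eventually_straight ray_fun }.

HB.instance Definition _ := gen_eqMixin ray_vertex.

Lemma ray_vertex_eq (f g : ray_vertex) : f =1 g -> f = g.
Proof.
case: f g => [f fP] [g gP] /= /funext fg; subst g.
by congr RayVertex; apply: Prop_irrelevance.
Qed.

Lemma tail_straight (f : ray_vertex) : eventually_straight (fun i => f i.+1).
Proof.
have [c [M fM]] := ray_funP f; exists (c + 1)%R, M => i Mi.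
by rewrite fM ?(leqW Mi) // PoszS addrA addrAC.
Qed.

Definition tail f := RayVertex (tail_straight f).

Lemma iter_tail m (f : ray_vertex) i : iter m tail f i = f (m + i)%N.
Proof. by elim: m i => //= m IHm i; rewrite IHm addnS. Qed.

Lemma tail_height : exists h : ray_vertex -> int,
  forall f, h (tail f) = (h f + 1)%R.
Proof.
have /choice[h hP] : forall f : ray_vertex, exists c : int, exists M : nat,
    forall i : nat, (M <= i)%N -> f i = (sg * (c + i%:Z))%R.
  by move=> f; apply: ray_funP.
exists h => f; have [M fM] := hP f; have [M' fM'] := hP (tail f).
have := fM (M + M').+1; have := fM' (M + M')%N; rewrite /= => -> //; last by lia.
by move=> /(_ _); rewrite /sg; case: eps; lia.
Qed.

(** For large [k], dropping [k - c] terms of [f] leaves the straight sequence with constant [k], and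
    so does dropping [k - d] terms of [g]. *)
Lemma tail_common_ancestor (f g : ray_vertex) :
  exists m n, iter m tail f = iter n tail g.
Proof.
have [c [M fM]] := ray_funP f; have [d [N gN]] := ray_funP g.
pose k := (M + N + absz c + absz d)%N.
exists (absz (k%:Z - c)%R), (absz (k%:Z - d)%R); apply: ray_vertex_eq => i.
by rewrite !iter_tail fM ?gN /k; lia.

Qed.

Lemma ray_vertex_inhabited : inhabited ray_vertex.
Proof.
have straight : eventually_straight (fun i => sg * i%:Z)%R.
  by exists 0%R, 0%N => i _; rewrite add0r.
exact: inhabits (RayVertex straight).
Qed.

Definition ray_tree : tree := parent_tree
  (projT2 (cid tail_height)) tail_common_ancestor ray_vertex_inhabited.

Lemma comp_straight (g : houghton2) (f : ray_vertex) :
  eventually_straight (fun i => g (f i)).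
Proof.
have [n [N gN]] := houghton2_eventually g; have [c [M fM]] := ray_funP f.
(* As [sg] squares to 1, adding [n] to the value adds [sg * n] to the constant; the bound puts [f i]
   where [g] is a translation. *)
exists (c + sg * n)%R, (M + N + absz c)%N => i iM.
rewrite gN fM; try by lia.
  by rewrite /sg; case: eps; lia.
by rewrite /sg; case: eps; lia.
Qed.

Definition ray_act g f := RayVertex (comp_straight g f).

Lemma ray_actM g h f : ray_act (g * h)%g f = ray_act g (ray_act h f).
Proof. exact: ray_vertex_eq. Qed.

Lemma ray_act1 f : ray_act 1%g f = f.
Proof. exact: ray_vertex_eq. Qed.

Lemma ray_actK g : cancel (ray_act g) (ray_act g^-1%g).
Proof. by move=> f; rewrite -ray_actM mulVg ray_act1. Qed.

Lemma ray_actVK g : cancel (ray_act g^-1%g) (ray_act g).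
Proof. by move=> f; rewrite -ray_actM mulgV ray_act1. Qed.

Definition ray_sym g : sym ray_tree := @Sym ray_tree _ _ (ray_actK g) (ray_actVK g).

Lemma ray_act_adj g (x y : ray_tree) : adj x y ->
  adj (ray_act g x : ray_tree) (ray_act g y : ray_tree).
Proof.
have tailE z : tail (ray_act g z) = ray_act g (tail z) by exact: ray_vertex_eq.
by case/orP => /eqP <-; apply/orP; [left | right]; apply/eqP/tailE.
Qed.

Lemma ray_sym_cellular g : ray_sym g \in cellular (@simplex ray_tree).
Proof. by apply: adj_cellular => x y; apply: ray_act_adj. Qed.

Definition ray_aut g : tree_aut ray_tree := CellAut (ray_sym_cellular g).

End RayTree.

(** * The proper action on the product of two trees, and the theorem *)

Definition two_ray_trees (i : 'I_2) : tree := ray_tree (i == ord0).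

Definition two_ray_action (g : houghton2) : prod_aut two_ray_trees :=
  prod_aut_of (fun i => ray_aut (i == ord0) g : tree_aut (two_ray_trees i)).

Lemma two_ray_actionM : {morph two_ray_action : g h / (g * h)%g}.
Proof.
move=> g h; apply/val_inj/sym_eqP => v.
by apply: functional_extensionality_dep => i; apply: ray_actM.
Qed.

HB.instance Definition _ :=
  isMultiplicative.Build houghton2 (prod_aut two_ray_trees) two_ray_action
    two_ray_actionM.

Lemma two_ray_action_proper : proper_action two_ray_action.
Proof.
move=> v.
have [c [M fM]] := ray_funP (v ord0); have [d [N gN]] := ray_funP (v ord_max).
pose b := (M + N + absz c + absz d)%N.
(* The integers from [-b] to [b]. Every larger one is a value of [v ord0] and every smaller one a
   value of [v ord_max], so an element fixing [v] fixes them all. *)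
pose s : seq int := [seq (k%:Z - b%:Z)%R | k <- iota 0 (b + b).+1].
apply: sub_finite_set (finite_houghton2_supported s) => g /= gv k ks.
have fix_range i j : g (ray_fun (v i) j) = ray_fun (v i) j.
  have e := congr1 (fun w : prod_vertex two_ray_trees => ray_fun (w i) j) gv.
  exact: e.
have big : (b < absz k)%N.
  rewrite ltnNge; apply/negP => le; move/negP: ks; apply; apply/mapP.
  by exists (absz (k + b%:Z)%R); rewrite ?mem_iota; lia.
have [pos|neg] : (0 <= k \/ k < 0)%R by lia.
  have := fix_range ord0 (absz (k - c)%R).
  rewrite fM; last by rewrite /b in big; lia.
  by rewrite /= (_ : 1 * _ = k)%R //; rewrite /b in big; lia.
have := fix_range ord_max (absz (- k - d)%R).
rewrite gN; last by rewrite /b in big; lia.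
by rewrite /= (_ : -1 * _ = k)%R //; rewrite /b in big; lia.
Qed.

Theorem theorem2p9 :
  [/\ finitely_generated houghton2,
      exists (T : 'I_2 -> tree) (rho : {multiplicative houghton2 -> prod_aut T}),
        preserves_factors rho /\ proper_action rho
    & forall (n : nat) (T : 'I_n -> tree), (forall i, locally_finite (T i)) ->
        ~ exists rho : {multiplicative houghton2 -> prod_aut T},
            proper_action rho].
Proof.
split; first exact: houghton2_finitely_generated.
  exists two_ray_trees, two_ray_action; split; last exact: two_ray_action_proper.
  by move=> g; exists (fun i => ray_aut (i == ord0) g).
by move=> n T T_lf [rho]; apply: not_proper.
Qed.
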